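(* Let $f$ be a field of characteristic $0$, and let $m\ge 0$ and $n>m$ be integers. (1) If $n\le 2m+2$, all the orbits of the co-adjoint representation of $G_{m+1,n+1}$ in $L_{m+1,n+1}^*$ are points, and every point is an orbit; all orbits are in general position. (2) If $n>2m+2$ and $n$ is odd, the orbits in general position of the co-adjoint representation of $G_{m+1,n+1}$ in $L_{m+1,n+1}^*$ are parametrized by $m+1$ numbers $c_0\in f^\ast=f\setminus\{0\}$, $c_1,\dots,c_m\in f$: they are the affine planes of dimension $n-2m-1$ defined by the equations $l_n=c_0,\ l_{n-1}=c_1,\dots,l_{n-m}=c_m$. (3) If $n>2m+2$ and $n$ is even, the orbits in general position are parametrized by $m+2$ numbers $c_0\in f^\ast$, $c_1,\dots,c_{m+1}\in f$: they are the affine varieties of dimension $n-2m-2$ defined by the equations $l_n=c_0,\ l_{n-1}=c_1,\dots,l_{n-m}=c_m,\ P_{mk}(l_n,l_{n-1},\dots,l_{n/2})=c_{m+1}$ with $k=(n/2)-m$. (4) Each orbit in general position of the co-adjoint representation of $G_{m+1,n+1}$ in $L_{m+1,n+1}^*$ is an orbit of the co-adjoint representation of $G_{m+1,i+1}$ in $L_{m+1,i+1}^*$ for all $i\ge n$, as well as of $G_{m+1}$ in $L_{m+1}^*$. (5) For every integer $i>m$, each orbit of the co-adjoint representation of $G_{m+1,i+1}$ in $L_{m+1,i+1}^*$ is an orbit in general position of the co-adjoint representation of $G_{m+1,n'+1}$ in $L_{m+1,n'+1}^*$ for some $n'$ with $\min(2m+2,i)\le n'\le i$. (6) Each orbit of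 the co-adjoint representation of $G_{m+1}$ in $L_{m+1}^*$ is an orbit in general position of the co-adjoint representation of $G_{m+1,n'+1}$ in $L_{m+1,n'+1}^*$ for some $n'\ge 2m+2$.
   Context: $W_1$ is the Lie algebra of $f$-derivations of $f[[t]]$, i.e. of expressions $\sum_{i\ge -1}a_il_i$, $a_i\in f$, $l_i=t^{i+1}\frac{\partial}{\partial t}$, so $[l_i,l_j]=(j-i)l_{i+j}$. $L_n$ is the subalgebra of elements with $a_i=0$ for $i<n$; for $0\le m<n$, $L_{mn}=L_m/L_n$, with basis the classes of $l_m,\dots,l_{n-1}$, still denoted $l_i$. $L_{mn}^*$ is the space of $f$-linear forms on $L_{mn}$; each $l_i$ is regarded as a linear coordinate function on it. The projections $L_m\to L_{mn}$ induce inclusions $L_{m,m+1}^*\subset L_{m,m+2}^*\subset\cdots\subset L_m^*$, where $L_m^*=\bigcup_k L_{m,m+k}^*$ (the continuous linear forms). $G_0$ is the group of automorphisms of the field $f((t))$ over $f$; its elements $g$ are determined by $g(t)=ct+o(t)$, $c\ne0$. For $n\ge1$, $G_n=\{g\in G_0: g(t)=t+o(t^n)\}$, where $o(t^n)$ denotes a series all of whose terms have degree $>n$; for $m\le n$, $G_n$ is normal in $G_m$ and $G_{mn}=G_m/G_n$. $G_m$ acts on $L_m$ (by conjugation of derivations), inducing an action of $G_{mn}$ on $L_{mn}$ for $m\geq 1$; the co-adjoint representations of $G_m$ and $G_{mn}$ are the dual actions on $L_m^*$ and $L_{mn}^*$. An orbit of $G_{m+1,n+1}$ in $L_{m+1,n+1}^*$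 is ''in general position'' if $n\le 2m+2$ (any orbit), or if $n>2m+2$ and $l_n\ne0$ on it. The polynomials $P_{mk}$ are defined by $$\sum_{k=1}^{\infty}P_{mk}(x_0,x_1,\dots,x_{m+k})z^k=\frac{\sqrt{\sum_{k=0}^{\infty}x_kx_0^{k-1}z^k}-\sqrt{\sum_{k=0}^{m}x_kx_0^{k-1}z^k}}{x_0^mz^m},$$ the square roots being the power series in $z$ with constant term $1$. *)

(* Defs.v *)
From HB Require Import structures.
From mathcomp Require Import all_boot all_order all_algebra.
From mathcomp Require Import boolp classical_sets functions.
From mathcomp Require Import mpoly.

Set Implicit Arguments.
Unset Strict Implicit.
Unset Printing Implicit Defensive.

Import GRing.Theory.
Local Open Scope ring_scope.
Local Open Scope classical_set_scope.

(** * Formal power series *)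

(* [ser R] is R[[t]]; the coefficient of t^i in [a] is [a i]. *)
Record ser (R : Type) := Ser { coefs :> nat -> R }.

HB.instance Definition _ (R : Type) := gen_eqMixin (ser R).
HB.instance Definition _ (R : Type) := gen_choiceMixin (ser R).

Lemma serP (R : Type) (a b : ser R) : (forall i, a i = b i) -> a = b.
Proof. by case: a b => [a] [b] /= /funext ->. Qed.

Section SerRing.
Variable R : comNzRingType.
Implicit Types a b c : ser R.

Definition ser_add a b := Ser (fun i => a i + b i).
Definition ser_opp a := Ser (fun i => - a i).
Definition ser_mul a b := Ser (fun n => \sum_(i < n.+1) a i * b (n - i)%N).
Definition serC (c : R) := Ser (fun i => if i == 0%N then c else 0).

Fact ser_addA : associative ser_add.
Proof. by move=> a b c; apply: serP => i /=; rewrite addrA. Qed.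
Fact ser_addC : commutative ser_add.
Proof. by move=> a b; apply: serP => i /=; rewrite addrC. Qed.
Fact ser_add0 : left_id (serC 0) ser_add.
Proof. by move=> a; apply: serP => i /=; rewrite if_same add0r. Qed.
Fact ser_addN : left_inverse (serC 0) ser_opp ser_add.
Proof. by move=> a; apply: serP => i /=; rewrite if_same addNr. Qed.

HB.instance Definition _ :=
  GRing.isZmodule.Build (ser R) ser_addA ser_addC ser_add0 ser_addN.

(* The ring axioms are transferred from {poly R} by truncation. *)
Let trunc n a : {poly R} := \poly_(i < n.+1) a i.

Let coef_trunc n a i : (i <= n)%N -> (trunc n a)`_i = a i.
Proof. by move=> lein; rewrite coef_poly ltnS lein. Qed.

Let mul_trunc n a b i : (i <= n)%N ->
  (trunc n a * trunc n b)`_i = ser_mul a b i.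
Proof.
move=> lein; rewrite coefM /=; apply: eq_bigr => j _.
have leji : (j <= i)%N by rewrite -ltnS.
by rewrite !coef_trunc // ?(leq_trans (leq_subr _ _)) ?(leq_trans leji).
Qed.

Fact ser_mulC : commutative ser_mul.
Proof.
by move=> a b; apply: serP => n; rewrite -!(mul_trunc _ _ (leqnn n)) mulrC.
Qed.

Fact ser_mulA : associative ser_mul.
Proof.
move=> a b c; apply: serP => n.
have -> : ser_mul a (ser_mul b c) n = (trunc n a * (trunc n b * trunc n c))`_n.
  rewrite coefM /=; apply: eq_bigr => j _.
  have lejn : (j <= n)%N by rewrite -ltnS.
  by rewrite coef_trunc // mul_trunc // leq_subr.
rewrite mulrA coefM /=; apply: eq_bigr => j _.
have lejn : (j <= n)%N by rewrite -ltnS.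
by rewrite mul_trunc // coef_trunc // leq_subr.
Qed.

Fact ser_mul1 : left_id (serC 1) ser_mul.
Proof.
move=> a; apply: serP => n /=; rewrite big_ord_recl /= mul1r subn0 big1 ?addr0 //.
by move=> i _; rewrite mul0r.
Qed.

Fact ser_mulDl : left_distributive ser_mul ser_add.
Proof.
move=> a b c; apply: serP => n /=; rewrite -big_split.
by apply: eq_bigr => i _; rewrite mulrDl.
Qed.

Fact ser_1neq0 : serC 1 != 0.
Proof.
by apply/eqP => /(congr1 (fun a : ser R => a 0%N))/eqP; rewrite /= oner_eq0.
Qed.

HB.instance Definition _ := GRing.Zmodule_isComNzRing.Build (ser R)
  ser_mulA ser_mulC ser_mul1 ser_mulDl ser_1neq0.

Definition serT : ser R := Ser (fun i => if i == 1%N then 1 else 0).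
Definition ser_deriv a := Ser (fun i => a i.+1 *+ i.+1).

(* The square root with constant term 1 of a series with constant term 1; it
   exists if 2 is invertible in R, and is unique if R is moreover a domain. *)
Definition ser_sqrt a : ser R := xget (0 : ser R) [set s : ser R | s 0%N = 1 /\ s * s = a].

Definition ser_unit : pred (ser R) := fun a => `[< exists b, b * a = 1 >].
Definition ser_inv a : ser R :=
  if ser_unit a then xget (0 : ser R) [set b : ser R | b * a = 1] else a.

Fact ser_mulV : {in ser_unit, left_inverse 1 ser_inv *%R}.
Proof.
move=> a ua; have {}ua : ser_unit a by [].
rewrite /ser_inv ua; move/asboolP: ua => [b ba].
by apply: (@xgetI _ (0 : ser R) [set b : ser R | b * a = 1] b).
Qed.

Fact ser_unitPl a b : b * a = 1 -> ser_unit a.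
Proof. by move=> ba; apply/asboolP; exists b. Qed.

Fact ser_inv_out : {in [predC ser_unit], ser_inv =1 id}.
Proof. move=> a ua; have {}ua : ~~ ser_unit a by [].
by rewrite /ser_inv (negbTE ua). Qed.

HB.instance Definition _ := GRing.ComNzRing_hasMulInverse.Build (ser R)
  ser_mulV ser_unitPl ser_inv_out.

End SerRing.

Section SerDomain.
Variable F : fieldType.

Fact ser_idomain (a b : ser F) : a * b = 0 -> (a == 0) || (b == 0).
Proof.
move=> ab0; apply: contrapT => /negP; rewrite negb_or => /andP[a0 b0].
have low (c : ser F) : c != 0 ->
    exists2 i, c i != 0 & forall j, (j < i)%N -> c j = 0.
  move=> c0; have ex : exists i, c i != 0.
    apply: contrapT => /forallNP h; move/eqP: c0; apply; apply: serP => i.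
    by rewrite [RHS]if_same; apply/eqP/negPn/negP/h.
  case: (ex_minnP ex) => i ci mini; exists i => // j ltji.
  by apply/eqP; apply: contraTT ltji => /mini; rewrite -leqNgt.
have [i ai lowi] := low a a0; have [k bk lowk] := low b b0.
have /eqP : (a * b) (i + k)%N = 0 by rewrite ab0 /= if_same.
have lt : (i < (i + k).+1)%N by rewrite ltnS leq_addr.
rewrite /= (bigD1 (Ordinal lt)) //= addKn big1 ?addr0 ?mulf_eq0.
  by rewrite (negbTE ai) (negbTE bk).
move=> j; rewrite -val_eqE /= => neji; case: (ltnP j i) => [/lowi->|leij].
  by rewrite mul0r.
rewrite lowk ?mulr0 // ltn_subLR; last by rewrite -ltnS ltn_ord.
by rewrite ltn_add2r ltn_neqAle eq_sym neji.
Qed.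

HB.instance Definition _ :=
  GRing.ComUnitRing_isIntegral.Build (ser F) ser_idomain.

End SerDomain.

(** * The field f((t)), its automorphisms over f, and the groups G_n *)

Notation laurent F := {fraction ser F}.
Notation tofr := (@FracField.tofrac _).

(* d/dt on f((t)), by the quotient rule. *)
Definition ddt (F : fieldType) (x : laurent F) : laurent F :=
  let p := \n_(repr x) in let q := \d_(repr x) in
  tofr (ser_deriv p * q - p * ser_deriv q) / tofr (q ^+ 2).

Record faut (F : fieldType) := Faut {
  faut_fun :> {rmorphism laurent F -> laurent F};
  faut_inv : {rmorphism laurent F -> laurent F};
  faut_funK : cancel faut_fun faut_inv;
  faut_invK : cancel faut_inv faut_fun;
  faut_const : forall c : F, faut_fun (tofr (serC c)) = tofr (serC c) }.

Fact faut_inv_const (F : fieldType) (g : faut F) (c : F) :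
  faut_inv g (tofr (serC c)) = tofr (serC c).
Proof. by rewrite -{1}(faut_const g) faut_funK. Qed.

Definition fautV (F : fieldType) (g : faut F) : faut F :=
  Faut (@faut_invK F g) (@faut_funK F g) (@faut_inv_const F g).

(* G_n is the set of g with g(t) = t + o(t^n); for n = 0 this is the condition
   g(t) = c t + o(t), since t + o(1) stands for any series without constant
   term. *)
Definition G (F : fieldType) (n : nat) : set (faut F) :=
  [set g | exists u : ser F, g (tofr (serT F)) = tofr (serT F + serT F ^+ n.+1 * u)].

(* G_{mn} = G_m / G_n, as the set of cosets g G_n with g in G_m. *)
Definition Gq (F : fieldType) (m n : nat) : set (set (faut F)) :=
  [set C | exists2 g, G m g &
     C = [set h : faut F | exists2 k, G n k & forall x, h x = g (k x)]].

(** * The Lie algebras L_m, L_{mn} and their duals *)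

(* An element a_m l_m + a_{m+1} l_{m+1} + ... of L_m is encoded by the series
   with coefficients a_m, a_{m+1}, ...; [vfield m a] is the derivation of
   f((t)) that it denotes (recall l_i = t^(i+1) d/dt). *)
Definition vfield (F : fieldType) (m : nat) (a : ser F) : laurent F -> laurent F :=
  fun x => tofr (serT F ^+ m.+1 * a) * ddt x.

(* Conjugation: [Ad m g a] encodes the derivation g \o D \o g^-1, where D is
   the element of L_m encoded by [a]. For g in G_m this derivation lies in L_m,
   and its encoding is unique, being read off its value at t; the default
   value 0 is then never used. *)
Definition Ad (F : fieldType) (m : nat) (g : faut F) (a : ser F) : ser F :=
  xget (0 : ser F) [set b : ser F | forall x, vfield m b x = g (vfield m a (fautV g x))].

(* L_{mn} = L_m / L_n, as coordinate vectors on the classes of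
   l_m, ..., l_{n-1}. *)
Notation L F m n := 'rV[F]_(n - m).

Definition Lproj (F : fieldType) (m n : nat) (a : ser F) : L F m n :=
  \row_(j < n - m) a j.

Definition Lsect (F : fieldType) (m n : nat) (v : L F m n) : ser F :=
  Ser (fun i => if insub i is Some j then v ord0 j else 0).

Definition Adq (F : fieldType) (m n : nat) (g : faut F) (v : L F m n) : L F m n :=
  Lproj m n (Ad m g (Lsect v)).

Notation Ldual F m n := 'Hom(L F m n, F^o).

(* The class of l_i in L_{mn}, for m <= i < n, as a coordinate on the dual. *)
Definition ell (F : fieldType) (m n i : nat) (v : Ldual F m n) : F :=
  v (\row_(j < n - m) (m + j == i)%N%:R).

(* The inclusion of L_{mn}^* into L_{mi}^* (n <= i), dual to the projection. *)
Definition Lincl (F : fieldType) (m n i : nat) (v : Ldual F m n) : Ldual F m i :=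
  linfun (fun w : L F m i => v (Lproj m n (Lsect w)) : F^o).

(* The inclusion of L_{mn}^* into the linear forms on L_m. *)
Definition Lincl_inf (F : fieldType) (m n : nat) (v : Ldual F m n) : ser F -> F :=
  fun a => v (Lproj m n a).

(* L_m^* is the union of the L_{m,m+k}^*. *)
Definition Ldual_inf (F : fieldType) (m : nat) : set (ser F -> F) :=
  [set lam | exists k, exists v : Ldual F m (m + k), lam = Lincl_inf v].

(** * Co-adjoint orbits *)

Definition coadq (F : fieldType) (m n : nat) (g : faut F) (v : Ldual F m n) :
    Ldual F m n :=
  linfun (fun w : L F m n => v (Adq (fautV g) w) : F^o).

Definition coad (F : fieldType) (m : nat) (g : faut F) (lam : ser F -> F) :
    ser F -> F :=
  fun a => lam (Ad m (fautV g) a).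

(* A class in G_{mn} acts on L_{mn}^* through its representatives. *)
Definition is_orbitq (F : fieldType) (m n : nat) (O : set (Ldual F m n)) :=
  exists v : Ldual F m n,
    O = [set w | exists2 C, Gq m n C & exists2 g, C g & w = coadq g v].

Definition is_orbit (F : fieldType) (m : nat) (O : set (ser F -> F)) :=
  exists2 lam, Ldual_inf m lam &
    O = [set mu | exists2 g, G m g & mu = coad m g lam].

Definition general_position (F : fieldType) (m n : nat)
    (O : set (Ldual F m.+1 n.+1)) :=
  (n <= 2 * m + 2)%N \/
  ((2 * m + 2 < n)%N /\ forall v, O v -> ell n v != 0).

(** * Affine planes and affine varieties *)

Definition affine_plane (F : fieldType) (V : vectType F) (d : nat) (X : set V) :=
  exists v : V, exists2 U : {vspace V}, \dim U = d &
    X = [set w | w - v \in U].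

Section Varieties.
Variables (F : fieldType) (N : nat).
Implicit Types X Y Z : set ('I_N -> F).

Definition zariski_closed X :=
  exists S : set {mpoly F[N]}, X = [set x | forall p, S p -> p.@[x] = 0].

Definition irreducible_set X :=
  X !=set0 /\
  forall Y Z, zariski_closed Y -> zariski_closed Z ->
    X `<=` Y `|` Z -> X `<=` Y \/ X `<=` Z.

(* The regular functions on X induced by the polynomials in [p] are
   algebraically independent over F. *)
Definition alg_indep X (d : nat) (p : d.-tuple {mpoly F[N]}) :=
  forall q : {mpoly F[d]},
    (forall x, X x -> q.@[fun i => (tnth p i).@[x]] = 0) -> q = 0.

(* The dimension is the transcendence degree of the function field, i.e. the
   cardinality of a transcendence basis (a maximal algebraically independent
   family), which can be taken in the coordinate ring. *)
Definition affine_variety (d : nat) X :=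
  [/\ zariski_closed X, irreducible_set X &
    exists2 p : d.-tuple {mpoly F[N]}, alg_indep X p &
      forall r, ~ alg_indep X [tuple of rcons p r]].

End Varieties.

(* A set of linear forms on L_{mn}, in the coordinates l_m, ..., l_{n-1}. *)
Definition in_coords (F : fieldType) (m n : nat) (X : set (Ldual F m n)) :
    set ('I_(n - m) -> F) :=
  [set x | exists2 v, X v & x = (fun j : 'I_(n - m) => ell (m + j) v)].

(** * The polynomials P_{mk} *)

Section PolyP.
Variables (F : fieldType) (m k : nat).

Let x (i : nat) : {mpoly F[(m + k).+1]} := 'X_(inord i).

(* The sum of x_i x_0^(i-1) z^i for i <= r; the term of index 0 is 1. *)
Definition xseries (r : nat) : ser {mpoly F[(m + k).+1]} :=
  Ser (fun i => if i == 0%N then 1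
                else if (i <= r)%N then x i * x 0 ^+ i.-1 else 0).

(* The variables x_i with i > m + k do not contribute to the coefficient of
   z^(m+k), so that the full sum can be cut at index m + k. *)
Definition Pmk_spec : set {mpoly F[(m + k).+1]} :=
  [set p | x 0 ^+ m * p =
             (ser_sqrt (xseries (m + k)) - ser_sqrt (xseries m)) (m + k)%N].

(* x_0^m divides the right-hand side of [Pmk_spec]: if A and B are the two
   square roots, then (A - B)(A + B) has coefficients divisible by x_0^m and
   A + B has the invertible constant term 2. *)
Definition Pmk : {mpoly F[(m + k).+1]} := xget (0 : {mpoly F[(m + k).+1]}) Pmk_spec.

End PolyP.

(* Main.v *)
Require Import Defs.
From HB Require Import structures.
From mathcomp Require Import all_boot all_order all_algebra.
From mathcomp Require Import boolp classical_sets functions.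
From mathcomp Require Import mpoly ring zify.

Set Implicit Arguments.
Unset Strict Implicit.
Unset Printing Implicit Defensive.

Import GRing.Theory.
Local Open Scope ring_scope.
Local Open Scope classical_set_scope.

(** A linear form on L_{m+1,n+1} is a residue pairing: the vector field A(t) d/dt
    is sent to the residue of A(t) q(t) dt, where q(t) dt^2 is the quadratic
    differential with q = t^-(n+2) (x_0 + x_1 t + x_2 t^2 + ...) and x_i is the
    value of the coordinate l_(n-i); only the x_i with i < n - m matter. Because
    residues are invariant under a change of variable ([residue_invariance]), the
    coadjoint action is the change of variable in quadratic differentials
    ([transformation_law]).

    An element of the group is a substitution t |-> t + u t^(s+1) + ... with
    s > m. It leaves x_0, ..., x_(s-1) alone and adds a multiple of
    (n - 2s) u x_0 to x_s ([shear]). If n <= 2m+2, there is no coordinate left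
    that could move, except the middle one if n = 2m+2, for which the factor
    n - 2s vanishes: all orbits are points. If n > 2m+2 and x_0 is not 0, then
    x_(m+1), x_(m+2), ... can be given arbitrary values one after the other,
    except for the middle coordinate x_(n/2) if n is even ([orbq_transitive]). In
    this case there is one more invariant, the residue of the differential whose
    square is q(t) dt^2, divided by x_0 in order that the root exist over f
    ([residue_sqrt_invariance]). When x_0, ..., x_m are given, P_mk is a function
    of this residue ([Pmk_eval]), and it is affine in x_(n/2)
    ([Pmk_linear]). So the orbits are the sets on which x_0, ..., x_m and, for even
    n, P_mk are constant; for even n such a set is the graph of a polynomial
    function over an affine space ([Pmk_hypersurface_variety]). The action commutes
    with the inclusions of the dual spaces, so that every orbit is in general
    position at the level given by its highest coordinate that does not vanish,
    or at a level not greater than 2m+2 ([minimal_level]).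

    The automorphisms of f((t)) are not assumed to be continuous. They preserve
    f[[t]] because y is integral if and only if 1 + t y^2 is a square
    ([integral_sqr]); hence they are the substitutions ([faut_scomp],
    [faut_exists]), and conjugation of derivations is given by an explicit formula
    ([AdE]). *)

(** * Power series modulo powers of t *)
Section Series.
Variable R : comNzRingType.
Implicit Types (a b c : ser R) (n i j : nat).

Notation T := (serT R).

Lemma coefsD a b i : (a + b) i = a i + b i. Proof. by []. Qed.
Lemma coefsB a b i : (a - b) i = a i - b i. Proof. by []. Qed.
Lemma coefs0 i : (0 : ser R) i = 0. Proof. by rewrite /= if_same. Qed.
Lemma coefsC (x : R) i : serC x i = if i == 0%N then x else 0. Proof. by []. Qed.
Lemma coefs1 i : (1 : ser R) i = if i == 0%N then 1 else 0. Proof. by []. Qed.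
Lemma coefsM a b n : (a * b) n = \sum_(i < n.+1) a i * b (n - i)%N.
Proof. by []. Qed.

Lemma coefsM0 a b : (a * b) 0%N = a 0%N * b 0%N.
Proof. by rewrite coefsM big_ord1. Qed.

Lemma coefsX0 a n : (a ^+ n) 0%N = a 0%N ^+ n.
Proof. by elim: n => [|n IH]; rewrite ?expr0 // !exprS coefsM0 IH. Qed.

Lemma coefsCM (x : R) a i : (serC x * a) i = x * a i.
Proof.
rewrite coefsM big_ord_recl /= subn0 big1 ?addr0 // => j _.
by rewrite mul0r.
Qed.

Lemma coefsTM a i : (T * a) i = if i is k.+1 then a k else 0.
Proof.
rewrite coefsM; case: i => [|k]; first by rewrite big_ord1 mul0r.
rewrite 2!big_ord_recl /= mul0r add0r mul1r big1 ?addr0 ?subn1 // => j _.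
by rewrite mul0r.
Qed.

Lemma coefsTnM n a i : (T ^+ n * a) i = if (i < n)%N then 0 else a (i - n)%N.
Proof.
elim: n i => [|n IH] i; first by rewrite mul1r subn0.
rewrite exprS -mulrA coefsTM; case: i => [|i]; first by [].
by rewrite IH ltnS subSS.
Qed.

Fact serC_is_zmod_morphism : zmod_morphism (@serC R).
Proof. by move=> x y; apply: serP => i /=; case: eqP; rewrite ?subr0. Qed.
Fact serC_is_monoid_morphism : monoid_morphism (@serC R).
Proof. by split=> // x y; apply: serP => i; rewrite coefsCM /=; case: eqP; rewrite ?mulr0. Qed.
HB.instance Definition _ := GRing.isZmodMorphism.Build R (ser R) (@serC R) serC_is_zmod_morphism.
HB.instance Definition _ := GRing.isMonoidMorphism.Build R (ser R) (@serC R) serC_is_monoid_morphism.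

(** Equality modulo T^n. All the analysis below takes place modulo powers of T;
    no topology is put on the series. *)
Definition cong n a b := forall i, (i < n)%N -> a i = b i.

Lemma cong_refl n a : cong n a a. Proof. by []. Qed.
Lemma cong_sym n a b : cong n a b -> cong n b a.
Proof. by move=> h i /h. Qed.
Lemma cong_trans n b a c : cong n a b -> cong n b c -> cong n a c.
Proof. by move=> h k i lt; rewrite h ?k. Qed.
Lemma congW k n a b : (k <= n)%N -> cong n a b -> cong k a b.
Proof. by move=> le h i lt; apply: h; apply: leq_trans le. Qed.
Lemma congD n a b a' b' : cong n a a' -> cong n b b' -> cong n (a + b) (a' + b').
Proof. by move=> h k i lt; rewrite !coefsD h ?k. Qed.
Lemma congB n a b a' b' : cong n a a' -> cong n b b' -> cong n (a - b) (a' - b').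
Proof. by move=> h k i lt; rewrite !coefsB h ?k. Qed.
Lemma congM n a b a' b' : cong n a a' -> cong n b b' -> cong n (a * b) (a' * b').
Proof.
move=> h k i lt; rewrite !coefsM; apply: eq_bigr => j _.
rewrite h ?k //; first by apply: leq_ltn_trans lt; rewrite leq_subr.
by apply: leq_ltn_trans lt; rewrite -ltnS.
Qed.
Lemma cong_eq a b : (forall n, cong n a b) -> a = b.
Proof. by move=> h; apply: serP => i; apply: (h i.+1). Qed.
Lemma congTS n a b : cong n a b -> cong n.+1 (T * a) (T * b).
Proof. by move=> h [|i] lt; rewrite !coefsTM // h. Qed.
Lemma congTn k n a b : cong n a b -> cong (k + n) (T ^+ k * a) (T ^+ k * b).
Proof.
move=> h i lt; rewrite !coefsTnM; case: ltnP => // le.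
by rewrite h // ltn_subLR.
Qed.
Lemma congTn0 n a : cong n (T ^+ n * a) 0.
Proof. by move=> i lt; rewrite coefsTnM lt coefs0. Qed.

Definition sdrop n a : ser R := Ser (fun i => a (n + i)%N).

Lemma cong_drop n a b : cong n a b -> a = b + T ^+ n * sdrop n (a - b).
Proof.
move=> h; apply: serP => i; rewrite coefsD coefsTnM.
case: ltnP => lt; first by rewrite addr0 h.
by rewrite /= subnKC // addrC subrK.
Qed.

(** Peeling off one coefficient at a time turns an identity between operations
    on series into an induction on the precision modulo which it holds. *)
Lemma ser_peel a : a = serC (a 0%N) + T * sdrop 1 a.
Proof.
by apply: serP => -[|i]; rewrite coefsD coefsTM coefsC /= ?addr0 ?add0r.
Qed.

Definition contracting (Phi : ser R -> ser R) :=
  forall n a b, cong n a b -> cong n.+1 (Phi a) (Phi b).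

(** The iterates of 0 are eventually constant modulo each power of T. Inverses,
    square roots and inverse substitutions are all obtained in this way. *)
Lemma contracting_fixpoint Phi : contracting Phi -> exists a, Phi a = a.
Proof.
move=> cP; pose s k := iter k Phi 0.
have sS k j : cong k (s k) (s (k + j)%N).
  elim: k j => [|k IH] j; first by move=> i.
  by rewrite addSn /s !iterS; apply: cP; apply: IH.
exists (Ser (fun i => s i.+1 i)); set x := Ser _; apply: cong_eq => n.
have h k : cong k x (s k).
  move=> i lt; have := sS i.+1 (k - i.+1)%N i (ltnSn i).
  by rewrite subnKC.
apply: (@congW n n.+1) => //; apply: (cong_trans _ (cong_sym (h _))).
exact: cP.
Qed.

End Series.

(** * Inverses and square roots of power series *)
Section Units.
Variable R : comUnitRingType.
Implicit Types (a b c : ser R) (n i j : nat).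
Notation T := (serT R).

(** If a = a_0 + T a', then b is inverse to a when b = a_0^-1 (1 - T a' b), and
    the right-hand side is a contraction in b. *)
Lemma coefs0_unit a : a 0%N \is a GRing.unit -> a \is a GRing.unit.
Proof.
move=> ua; pose Phi b := serC (a 0%N)^-1 * (1 - T * (sdrop 1 a * b)).
have [|b bP] := @contracting_fixpoint _ Phi.
  move=> n b b' bb; apply: congM => //; apply: congB => //; apply: congTS.
  exact: congM.
apply/unitrP; exists b; rewrite mulrC.
suff e : a * b = 1 by [].
rewrite {1}(ser_peel a) mulrDl -{1}bP /Phi mulrA -rmorphM divrr // rmorph1 mul1r.
by rewrite mulrA subrK.
Qed.

Hypothesis u2 : (2%:R : R) \is a GRing.unit.

(** If a = 1 + T a', then 1 + T x is a square root of a when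
    x = (a' - T x^2) / 2, which is a contraction in x. *)
Lemma sqrt_exists a : a 0%N = 1 -> exists2 b : ser R, b 0%N = 1 & b * b = a.
Proof.
move=> a0; pose h := (2%:R : R)^-1.
pose Phi x := serC h * (sdrop 1 a - T * (x * x)).
have [|x xP] := @contracting_fixpoint _ Phi.
  move=> n b b' bb; apply: congM => //; apply: congB => //; apply: congTS.
  exact: congM.
exists (1 + T * x); first by rewrite coefsD coefsTM addr0.
have e : 2%:R * x + T * (x * x) = sdrop 1 a.
  rewrite -{1}xP /Phi mulrA -[2%:R](rmorph_nat (@serC R)) -rmorphM mulrV //.
  by rewrite rmorph1 mul1r subrK.
by rewrite [in RHS](ser_peel a) a0 rmorph1 -e; ring.
Qed.

Lemma unit_sum1 a b : a 0%N = 1 -> b 0%N = 1 -> a + b \is a GRing.unit.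
Proof. by move=> a0 b0; apply: coefs0_unit; rewrite coefsD a0 b0. Qed.

Lemma cong_unitl (u : ser R) n a b : u \is a GRing.unit ->
  cong n (u * a) (u * b) -> cong n a b.
Proof.
by move=> uu /(congM (@cong_refl _ n u^-1)); rewrite !mulrA mulVr // !mul1r.
Qed.

(** The difference of the squares is (a + b) (a - b), where a + b has constant
    term 2. *)
Lemma cong_sqr n a b : a 0%N = 1 -> b 0%N = 1 -> cong n (a * a) (b * b) -> cong n a b.
Proof.
move=> a0 b0 h; apply: (@cong_unitl (a + b)); first exact: unit_sum1.
move=> i lt.
have -> : (a + b) * a = a * a + a * b by ring.
have -> : (a + b) * b = b * b + a * b by ring.
by rewrite !coefsD h.
Qed.

(** At the first coefficient where two roots differ, squaring acts as
    multiplication by 2. Hence the top coefficient of a square root is an affine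
    function of that of the series, which makes P_mk affine in its last
    variable. *)
Lemma coefs_sqr n a b : a 0%N = 1 -> b 0%N = 1 -> cong n a b ->
  (a * a) n - (b * b) n = 2%:R * (a n - b n).
Proof.
move=> a0 b0 h; rewrite {1 2}(cong_drop h); set c := sdrop n (a - b).
rewrite -coefsB.
have -> : (b + T ^+ n * c) * (b + T ^+ n * c) - b * b = T ^+ n * (c * (a + b)).
  by rewrite {1}(cong_drop h) -/c; ring.
rewrite coefsTnM ltnn subnn coefsM0 coefsD a0 b0 /c /= addn0.
by rewrite mulrC.
Qed.

Lemma ser_sqrtP a : a 0%N = 1 -> ser_sqrt a 0%N = 1 /\ ser_sqrt a * ser_sqrt a = a.
Proof.
move=> a0; have [b b0 bb] := sqrt_exists a0.
exact: (@xgetI _ (0 : ser R) [set s : ser R | s 0%N = 1 /\ s * s = a] b).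
Qed.

End Units.

(** * The derivative of a power series *)
Section Deriv.
Variable R : comNzRingType.
Implicit Types (a b c : ser R).
Notation T := (serT R).
Notation D := (@ser_deriv R).

Lemma coefs_deriv a i : D a i = a i.+1 *+ i.+1. Proof. by []. Qed.
Lemma sderivD a b : D (a + b) = D a + D b.
Proof. by apply: serP => i; rewrite coefsD /= mulrnDl. Qed.
Lemma sderivC x : D (serC x) = 0.
Proof. by apply: serP => i; rewrite coefs0 /= mul0rn. Qed.
Lemma sderivT : D T = 1.
Proof. by apply: serP => -[|i] /=; rewrite ?mul0rn. Qed.
Lemma sderivTM a : D (T * a) = a + T * D a.
Proof.
apply: serP => i; rewrite coefsD !coefs_deriv !coefsTM.
by case: i => [|i]; rewrite ?addr0 // mulrS.
Qed.
Lemma sderivM a b : D (a * b) = D a * b + a * D b.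
Proof.
suff h n : forall a b, cong n (D (a * b)) (D a * b + a * D b).
  by apply: cong_eq => n; apply: h.
elim: n => [|n IH] {}a {}b; first by move=> i.
rewrite (ser_peel a); set x := serC _; set y := sdrop 1 a.
have xM z : D (x * z) = x * D z.
  by apply: serP => i; rewrite coefsCM !coefs_deriv coefsCM mulrnAr.
have -> : (x + T * y) * b = x * b + T * (y * b) by ring.
rewrite !sderivD sderivC add0r !sderivTM xM.
have -> : (y + T * D y) * b + (x + T * y) * D b =
  x * D b + (y * b + T * (D y * b + y * D b)) by ring.
by do 2!apply: congD => //; apply: congTS.
Qed.
Lemma sderivX a n : D (a ^+ n) = n%:R * a ^+ n.-1 * D a.
Proof.
elim: n => [|n IH]; first by rewrite !mul0r expr0 -(rmorph1 (@serC R)) sderivC.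
rewrite exprS sderivM IH; case: n {IH} => [|n] /=; first by rewrite !expr0; ring.
by rewrite [in RHS]exprS [in X in _ * X]exprS -!natr1; ring.
Qed.

End Deriv.

(** * Substitution into power series *)
Section Composition.
Variables (R : comNzRingType) (w : ser R).
Implicit Types (a b c : ser R).
Notation T := (serT R).
Notation D := (@ser_deriv R).

(** The series a(T w). Substituting T w, rather than a series h assumed to have
    no constant term, makes [scomp] a ring morphism unconditionally. *)
Definition scomp a : ser R := Ser (fun n => \sum_(i < n.+1) a i * ((T * w) ^+ i) n).

(** The sum that defines a coefficient may be prolonged, since (T w)^i has no
    term of degree less than i. *)
Lemma scompE N a n : (n < N)%N -> scomp a n = \sum_(i < N) a i * ((T * w) ^+ i) n.
Proof.
move=> lt; rewrite /= (big_ord_widen N (fun i => a i * ((T * w) ^+ i) n)) //.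
rewrite big_mkcond; apply: eq_bigr => i _; case: ltnP => // le.
by rewrite exprMn coefsTnM le mulr0.
Qed.

Fact scomp_is_zmod_morphism : zmod_morphism scomp.
Proof.
move=> a b; apply: serP => n; rewrite coefsB !(scompE _ (ltnSn n)) -sumrB.
by apply: eq_bigr => i _; rewrite coefsB mulrBl.
Qed.
HB.instance Definition _ := GRing.isZmodMorphism.Build (ser R) (ser R) scomp scomp_is_zmod_morphism.

Lemma scompC x : scomp (serC x) = serC x.
Proof.
apply: serP => n; rewrite (scompE _ (ltnSn n)) big_ord_recl big1 ?addr0.
  by rewrite expr0 coefs1 !coefsC /=; case: eqP; rewrite ?mulr1 ?mulr0.
by move=> i _; rewrite coefsC mul0r.
Qed.

Lemma scompTM a : scomp (T * a) = T * w * scomp a.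
Proof.
apply: serP => n; rewrite (@scompE n.+2) // big_ord_recl coefsTM mul0r add0r.
transitivity (\sum_(i < n.+1) a i * (T * w * (T * w) ^+ i) n).
  by apply: eq_bigr => i _; rewrite coefsTM -exprS.
rewrite coefsM.
under [RHS]eq_bigr => j _ do rewrite (@scompE n.+1) ?ltnS ?leq_subr // mulr_sumr.
rewrite exchange_big; apply: eq_bigr => i _.
by rewrite coefsM mulr_sumr; apply: eq_bigr => j _; rewrite mulrCA.
Qed.

Lemma scompD a b : scomp (a + b) = scomp a + scomp b.
Proof. exact: raddfD. Qed.

Lemma cong_scomp n a b : cong n a b -> cong n (scomp a) (scomp b).
Proof.
move=> h i lt; apply: eq_bigr => j _; rewrite h //.
by apply: leq_ltn_trans lt; rewrite -ltnS.
Qed.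

Fact scomp_is_monoid_morphism : monoid_morphism scomp.
Proof.
split; first exact: scompC.
suff h n : forall a b, cong n (scomp (a * b)) (scomp a * scomp b).
  by move=> a b; apply: cong_eq => n; apply: h.
elim: n => [|n IH] a b; first by move=> i.
rewrite (ser_peel a); set x := a 0%N; set y := sdrop 1 a.
have xM c : scomp (serC x * c) = serC x * scomp c.
  apply: serP => i; rewrite coefsCM !(scompE _ (ltnSn i)) mulr_sumr.
  by apply: eq_bigr => j _; rewrite coefsCM mulrA.
have -> : (serC x + T * y) * b = serC x * b + T * (y * b) by ring.
rewrite !raddfD /= !scompTM xM scompC.
have -> : (serC x + T * w * scomp y) * scomp b =
   serC x * scomp b + T * (w * (scomp y * scomp b)) by ring.
by apply: congD => //; rewrite -mulrA; apply: congTS; apply: congM.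
Qed.
HB.instance Definition _ := GRing.isMonoidMorphism.Build (ser R) (ser R) scomp scomp_is_monoid_morphism.

Lemma scompT : scomp T = T * w.
Proof. by rewrite -[T in LHS]mulr1 scompTM rmorph1 mulr1. Qed.

Lemma scomp0 a : scomp a 0%N = a 0%N.
Proof. by rewrite (@scompE 1) // big_ord1 expr0 coefs1 mulr1. Qed.

Lemma chain_rule a : D (scomp a) = scomp (D a) * D (T * w).
Proof.
suff h n : forall a, cong n (D (scomp a)) (scomp (D a) * D (T * w)).
  by apply: cong_eq => n; apply: h.
elim: n => [|n IH] {}a; first by move=> i.
rewrite (ser_peel a); set x := a 0%N; set y := sdrop 1 a.
rewrite sderivD raddfD /= scompC scompTM sderivD !sderivC !add0r.
rewrite sderivTM sderivM raddfD /= scompTM.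
have -> : (scomp y + T * w * scomp (D y)) * D (T * w) =
  D (T * w) * scomp y + T * (w * (scomp (D y) * D (T * w))) by ring.
by apply: congD => //; rewrite -mulrA; apply: congTS; apply: congM.
Qed.

Lemma scomp_near_id s u a : w = 1 + T ^+ s * u -> cong s.+1 (scomp a) a.
Proof.
move=> wE; suff h k : (k <= s)%N -> forall a, cong k.+1 (scomp a) a by apply: h.
elim: k => [|k IH] le {}a; first by move=> [|i] // _; apply: scomp0.
rewrite (ser_peel a); set x := a 0%N; set y := sdrop 1 a.
rewrite raddfD /= scompC scompTM; apply: congD => //; rewrite -mulrA.
apply: congTS; rewrite -[y in X in cong _ _ X]mul1r.
apply: congM; last exact: IH (ltnW le) y.
rewrite wE -[X in cong _ _ X]addr0; apply: congD => //.
by apply: congW le _; apply: congTn0.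
Qed.

Hypothesis w0 : w 0%N = 1.

(** As w has constant term 1, a(T w) - a vanishes to one order more than a.
    Hence b = a(T w) has the solution a fixed by a |-> b - (a(T w) - a), and only
    this one. *)
Lemma scomp_bij : exists2 k : ser R -> ser R, cancel scomp k & cancel k scomp.
Proof.
have low n a b : cong n a b -> cong n.+1 (scomp a - a) (scomp b - b).
  move=> /cong_drop ->; set c := sdrop _ _.
  rewrite raddfD /= rmorphM rmorphXn /= scompT exprMn.
  have -> : scomp b + T ^+ n * w ^+ n * scomp c - (b + T ^+ n * c) =
    (scomp b - b) + T ^+ n * (w ^+ n * scomp c - c) by ring.
  rewrite -[X in cong _ _ X]addr0; apply: congD => //.
  rewrite -(mulr0 (T ^+ n)) -[n.+1]addn1; apply: congTn => -[|i] // _.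
  by rewrite coefsB coefsM0 coefsX0 w0 expr1n mul1r scomp0 subrr.
have surj b : exists a, scomp a == b.
  pose Phi a := b - (scomp a - a).
  have [|a aP] := @contracting_fixpoint _ Phi.
    by move=> n a a' aa; apply: congB => //; apply: low.
  exists a; apply/eqP; move: aP; rewrite /Phi => /(canRL (subrK _)) ->.
  by rewrite addrC subrK.
have inj : injective scomp.
  move=> a b ab; apply: cong_eq; elim=> [|n IH]; first by move=> i.
  have := low _ _ _ IH; rewrite ab => /(congB (@cong_refl _ _ (scomp b))).
  by rewrite !subKr.
have kP b : scomp (xchoose (surj b)) = b by apply/eqP; exact: (xchooseP (surj b)).
by exists (fun b => xchoose (surj b)) => // a; apply: inj; rewrite kP.
Qed.

End Composition.

(** * Characteristic zero *)
Section CharZero.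
Variables (F : fieldType) (char0 : [pchar F] =i pred0).

Lemma natr_inj n k : (n%:R = k%:R :> F) -> n = k.
Proof.
wlog le : n k / (n <= k)%N => [H e|].
  by case: (leqP n k) => [/H|/ltnW/H h]; [apply|apply/esym/h].
move/eqP; rewrite eq_sym -subr_eq0 -natrB // (proj1 (pcharf0P F) char0) subn_eq0.
by move=> ge; apply/eqP; rewrite eqn_leq le.
Qed.

Lemma natr_neq0 n : (n.+1%:R : F) != 0.
Proof. by rewrite (proj1 (pcharf0P F) char0). Qed.

Lemma unit2 : (2%:R : F) \is a GRing.unit.
Proof. by rewrite unitfE (natr_neq0 1). Qed.

(** The square root with constant term 1 of phi / phi_0: as phi_0 need not be a
    square in F, phi itself need not have a square root. *)
Definition normal_sqrt (phi : ser F) : ser F := ser_sqrt (serC (phi 0%N)^-1 * phi).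

Lemma normal_sqrtP (phi : ser F) : phi 0%N != 0 ->
  normal_sqrt phi 0%N = 1 /\
  serC (phi 0%N) * (normal_sqrt phi * normal_sqrt phi) = phi.
Proof.
move=> phi0; have [|e0 e] := @ser_sqrtP _ unit2 (serC (phi 0%N)^-1 * phi).
  by rewrite coefsCM mulVf.
by split=> //; rewrite /normal_sqrt e mulrA -rmorphM mulfV // rmorph1 mul1r.
Qed.

End CharZero.

(** * Invariance of residues *)
Section Residue.
Variables (F : fieldType) (char0 : [pchar F] =i pred0) (w : ser F).
Hypothesis w0 : w 0%N = 1.
Implicit Types (a b c : ser F).
Notation T := (serT F).
Notation D := (@ser_deriv F).

Lemma unit_w : w \is a GRing.unit.
Proof. by apply: coefs0_unit; rewrite w0 unitr1. Qed.

(** The residue of h^-e dh for h = T w. If e > 1 then h^-e dh is the derivative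
    of h^(1 - e) / (1 - e), so that its residue vanishes. *)
Lemma residue_pow e : (0 < e)%N -> (w^-1 ^+ e * D (T * w)) e.-1 = (e == 1%N)%:R.
Proof.
set v := w^-1; have vw : v * w = 1 by rewrite mulVr ?unit_w.
rewrite sderivTM; case: e => // -[|k] _; rewrite -pred_Sn.
  rewrite expr1 coefsM0 coefsD coefsTM addr0 w0 mulr1.
  by have /(congr1 (fun a : ser F => a 0%N)) := vw; rewrite coefsM0 w0 mulr1 => ->.
have Dv : D v = - (v ^+ 2 * D w).
  have : D (v * w) = 0 by rewrite vw -(rmorph1 (@serC F)) sderivC.
  rewrite sderivM => /(congr1 ( *%R v)); rewrite mulr0 mulrDr.
  rewrite [v * (_ * w)]mulrCA vw mulr1 => /eqP; rewrite addr_eq0 => /eqP ->.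
  by rewrite mulrA expr2.
have : k.+1%:R * (v ^+ k.+2 * (w + T * D w)) = k.+1%:R * v ^+ k.+1 - T * D (v ^+ k.+1).
  have -> : v ^+ k.+2 * (w + T * D w) = v ^+ k.+1 * (v * w) + T * (v ^+ k.+2 * D w).
    by rewrite !exprS; ring.
  by rewrite vw mulr1 sderivX Dv /= !exprS; ring.
move=> /(congr1 (fun a : ser F => a k.+1)).
rewrite coefsB -!(rmorph_nat (@serC F)) !coefsCM coefsTM coefs_deriv -[X in _ - X]mulr_natl subrr.
by move=> /eqP; rewrite mulf_eq0 (negbTE (natr_neq0 char0 _)) => /eqP.
Qed.

(** The residue of T^-(q + 1) a(T) dT is preserved by the substitution
    T |-> T w: by linearity it suffices to consider a power of T, which is
    [residue_pow]. *)
Lemma residue_invariance q a :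
  (w^-1 ^+ q.+1 * D (T * w) * scomp w a) q = a q.
Proof.
have vw : w^-1 * w = 1 by rewrite mulVr ?unit_w.
elim: q a => [|q IH] a; rewrite {1}(ser_peel a); set x := a 0%N; set y := sdrop 1 a.
  rewrite scompD scompC scompTM mulrDr coefsD mulrC coefsCM.
  rewrite residue_pow // mulr1.
  have -> : w^-1 ^+ 1 * D (T * w) * (T * w * scomp w y) =
    T * (w^-1 ^+ 1 * D (T * w) * (w * scomp w y)) by ring.
  by rewrite coefsTM addr0.
rewrite scompD scompC scompTM mulrDr coefsD mulrC coefsCM residue_pow // mulr0 add0r.
rewrite exprS.
have -> : w^-1 * w^-1 ^+ q.+1 * D (T * w) * (T * w * scomp w y) =
 (w^-1 * w) * (T * (w^-1 ^+ q.+1 * D (T * w) * scomp w y)) by ring.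
by rewrite vw mul1r coefsTM IH.
Qed.

End Residue.

(** * Orders of power series *)
Section Orders.
Variable F : fieldType.
Notation T := (serT F).
Implicit Types (a b : ser F).

Lemma order_factor a : a != 0 -> exists e (u : ser F), u 0%N != 0 /\ a = T ^+ e * u.
Proof.
move=> a0; have ex : exists i, a i != 0.
  apply: contrapT => /forallNP h; move/eqP: a0; apply; apply: serP => i.
  by rewrite coefs0; apply/eqP/negPn/negP/h.
case: (ex_minnP ex) => e ae mine; exists e, (sdrop e a); split.
  by rewrite /= addn0.
rewrite {1}(@cong_drop _ e a 0) ?add0r ?subr0 // => i lt; rewrite coefs0.
by apply/eqP; apply: contraTT lt => /mine; rewrite -leqNgt.
Qed.

Lemma order_uniq e f (u v : ser F) : u 0%N != 0 -> v 0%N != 0 ->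
  T ^+ e * u = T ^+ f * v -> e = f.
Proof.
wlog le : e f u v / (e <= f)%N => [H|] u0 v0 E.
  case: (leqP e f) => [le|/ltnW le]; first exact: (H e f u v).
  by symmetry; apply: (H f e v u).
apply/eqP; rewrite eqn_leq le /= leqNgt; apply/negP => lt.
have /(congr1 (fun a : ser F => a e)) := E.
by rewrite !coefsTnM ltnn subnn lt => /eqP; rewrite (negbTE u0).
Qed.

Lemma serT_neq0 : T != 0.
Proof.
by apply/eqP => /(congr1 (fun a : ser F => a 1%N)); rewrite coefs0 /= => /eqP; rewrite oner_eq0.
Qed.

Lemma coefs_neq0 a i : a i != 0 -> a != 0.
Proof. by apply: contraNneq => ->; rewrite coefs0. Qed.

Lemma coefs0_unitF a : a 0%N != 0 -> a \is a GRing.unit.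
Proof. by move=> a0; apply: coefs0_unit; rewrite unitfE. Qed.

End Orders.

(** * Fractions of power series *)
Section Fractions.
Variable F : fieldType.
Notation T := (serT F).
Notation D := (@ser_deriv F).
Implicit Types (p q r s a b : ser F) (x y : laurent F).

Lemma tofr_eq0 p : (tofr p == 0) = (p == 0).
Proof. exact: tofrac_eq0. Qed.

Lemma tofr_inj : injective (tofr : ser F -> laurent F).
Proof. by move=> p q /eqP; rewrite tofrac_eq => /eqP. Qed.

Lemma laurent_numden x : x = tofr \n_(repr x) / tofr \d_(repr x).
Proof.
have d0 := denom_ratioP (repr x).
apply: (canRL (mulfK _)); first by rewrite tofr_eq0.
rewrite -{1}[x]reprK; set r := repr x; rewrite -/r in d0.
change (FracField.mul (\pi_(laurent F)%qT r) (tofr \d_r) = tofr \n_r).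
rewrite !piE; apply/eqmodP; rewrite /= FracField.equivfE /FracField.mulf.
by rewrite !numden_Ratio ?oner_eq0 ?mulr1 // mulrC.
Qed.

Lemma laurentP x : exists p q, q != 0 /\ x = tofr p / tofr q.
Proof.
exists \n_(repr x), \d_(repr x); split; first exact: denom_ratioP.
exact: laurent_numden.
Qed.

Lemma frac_eqP p q r s : q != 0 -> s != 0 ->
  (tofr p / tofr q = tofr r / tofr s :> laurent F) <-> p * s = r * q.
Proof.
move=> q0 s0; rewrite -tofr_eq0 in q0; rewrite -tofr_eq0 in s0.
split=> e.
  by apply: tofr_inj; move/eqP: e; rewrite (eqr_div _ _ q0 s0) -!tofracM => /eqP.
by apply/eqP; rewrite (eqr_div _ _ q0 s0) -!tofracM e.
Qed.

Lemma ddtE p q : q != 0 ->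
  ddt (tofr p / tofr q) = tofr (D p * q - p * D q) / tofr (q ^+ 2).
Proof.
move=> q0; set x := _ / _; rewrite /ddt.
have := laurent_numden x; set n := \n_(repr x); set d := \d_(repr x).
have d0 : d != 0 := denom_ratioP _.
rewrite {1}/x => /frac_eqP -/(_ q0 d0) e.
apply/frac_eqP; rewrite ?expf_neq0 //.
have De : D n * q = D p * d + p * D d - n * D q.
  by have := congr1 D e; rewrite !sderivM => ->; rewrite addrK.
have -> : (D n * d - n * D d) * q ^+ 2 = D n * q * d * q - (n * q) * D d * q by ring.
rewrite De -e.
have -> : (D p * d + p * D d - n * D q) * d * q - p * d * D d * q =
  D p * d ^+ 2 * q - (n * q) * d * D q by ring.
by rewrite -e; ring.
Qed.

Lemma ddt_tofr p : ddt (tofr p) = tofr (D p).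
Proof.
have -> : tofr p = tofr p / tofr 1 :> laurent F by rewrite rmorph1 divr1.
rewrite ddtE ?oner_neq0 // expr1n rmorph1 divr1 -(rmorph1 (@serC F)) sderivC.
by rewrite mulr0 subr0 rmorph1 mulr1.
Qed.

Section FractionMap.
Variables (phi : {rmorphism ser F -> ser F}) (phi_inj : injective phi).

(** The extension of an injective endomorphism of f[[t]] to the fractions. *)
Definition fmap x : laurent F := tofr (phi \n_(repr x)) / tofr (phi \d_(repr x)).

Let phi_neq0 q : q != 0 -> phi q != 0.
Proof. by apply: contraNneq => q0; apply/eqP/phi_inj; rewrite q0 rmorph0. Qed.

Lemma fmapE p q : q != 0 -> fmap (tofr p / tofr q) = tofr (phi p) / tofr (phi q).
Proof.
move=> q0; set x := _ / _; rewrite /fmap.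
have := laurent_numden x; set n := \n_(repr x); set d := \d_(repr x).
have d0 : d != 0 := denom_ratioP _.
rewrite {1}/x => /frac_eqP -/(_ q0 d0) e.
by apply/frac_eqP; rewrite ?phi_neq0 // -!rmorphM e.
Qed.

Lemma fmap_tofr p : fmap (tofr p) = tofr (phi p).
Proof.
have -> : tofr p = tofr p / tofr 1 :> laurent F by rewrite rmorph1 divr1.
by rewrite fmapE ?oner_neq0 // !rmorph1 divr1.
Qed.

Fact fmap_is_zmod_morphism : zmod_morphism fmap.
Proof.
move=> x y; have [p [q [q0 ->]]] := laurentP x; have [r [s [s0 ->]]] := laurentP y.
have q1 : tofr q != 0 :> laurent F by rewrite tofr_eq0.
have s1 : tofr s != 0 :> laurent F by rewrite tofr_eq0.
have e (a b c d : laurent F) : b != 0 -> d != 0 ->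
    a / b - c / d = (a * d - c * b) / (b * d).
  by move=> b0 d0; rewrite -mulNr addf_div // mulNr.
rewrite e // -!rmorphM -rmorphB !fmapE ?mulf_neq0 // e ?tofr_eq0 ?phi_neq0 //.
by rewrite !(rmorphB, rmorphM).
Qed.

Fact fmap_is_monoid_morphism : monoid_morphism fmap.
Proof.
split; first by rewrite -(rmorph1 tofr) fmap_tofr !rmorph1.
move=> x y; have [p [q [q0 ->]]] := laurentP x; have [r [s [s0 ->]]] := laurentP y.
by rewrite mulf_div -!rmorphM !fmapE ?mulf_neq0 // !rmorphM mulf_div.
Qed.

Definition fmap_morph : {rmorphism laurent F -> laurent F} :=
  HB.pack fmap (GRing.isZmodMorphism.Build _ _ fmap fmap_is_zmod_morphism)
    (GRing.isMonoidMorphism.Build _ _ fmap fmap_is_monoid_morphism).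

End FractionMap.

End Fractions.

(** * Automorphisms of f((t)) as substitutions *)
Section Integrality.
Variables (F : fieldType) (char0 : [pchar F] =i pred0).
Notation T := (serT F).
Notation D := (@ser_deriv F).
Implicit Types (p q r s a b u w : ser F) (x y : laurent F) (g k : faut F).

Definition integral x := exists a, x = tofr a.

(** If y is integral, then 1 + T w y^2 has constant term 1, hence is a square.
    If y has a pole, then 1 + T w y^2 has odd order, hence is not a square. So
    integrality can be expressed in terms of the field structure and of T w
    alone. *)
Lemma integral_sqr w y : w 0%N = 1 ->
  integral y <-> exists z, 1 + tofr (T * w) * y ^+ 2 = z ^+ 2.
Proof.
move=> w0; split.
  move=> [a ->]; have [|b b0 bb] := @sqrt_exists _ (unit2 char0) (1 + T * w * a ^+ 2).
    by rewrite coefsD -mulrA coefsTM addr0.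
  by exists (tofr b); rewrite -!rmorphXn [b ^+ 2]expr2 bb rmorphD rmorph1 -rmorphM.
move=> [z]; have [p [q [q0 ->]]] := laurentP y; have [r [s [s0 ->]]] := laurentP z.
have [->|p0] := eqVneq p 0; first by exists 0; rewrite !rmorph0 mul0r.
have [e [u [u0 pE]]] := order_factor p0.
have [f [v [v0 qE]]] := order_factor q0.
have [o [t [t0 sE]]] := order_factor s0.
(* Clearing denominators in the case of a pole would give an odd order on the
   left and an even order on the right. *)
have [le _|lt] := leqP f e.
  exists (T ^+ (e - f) * u * v^-1).
  have uv : v \is a GRing.unit by apply: coefs0_unitF.
  rewrite -[RHS]divr1 -(rmorph1 tofr); apply/frac_eqP; rewrite ?oner_neq0 //.
  rewrite mulr1 pE qE -{1}(subnK le) exprD.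
  have -> : T ^+ (e - f) * u / v * (T ^+ f * v) = T ^+ (e - f) * T ^+ f * u * (v^-1 * v).
    by ring.
  by rewrite mulVr // mulr1.
have q1 : tofr q != 0 :> laurent F by rewrite tofr_eq0.
rewrite !expr_div_n -!rmorphXn mulrA -rmorphM -[1](divff (_ : tofr (q ^+ 2) != 0)).
  2: by rewrite tofr_eq0 expf_neq0.
rewrite -mulrDl -rmorphD => /frac_eqP; rewrite !expf_neq0 // => /(_ isT isT) E.
have d1 : (2 * f - (2 * e).+1 = (2 * (f - e) - 2).+1)%N.
  by rewrite mulnBr; have := lt; lia.
have E1 : q ^+ 2 + T * w * p ^+ 2 =
    T ^+ (2 * e).+1 * (w * u ^+ 2 + T ^+ (2 * f - (2 * e).+1) * v ^+ 2).
  have e2 : (f * 2 = (2 * e).+1 + (2 * f - (2 * e).+1))%N by lia.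
  rewrite pE qE !exprMn -!exprM {1}e2 exprD [(e * 2)%N]mulnC exprS.
  by ring.
have c0 : (w * u ^+ 2 + T ^+ (2 * f - (2 * e).+1) * v ^+ 2) 0%N != 0.
  rewrite coefsD coefsTnM d1 ltn0Sn addr0 coefsM0 w0 mul1r coefsX0.
  by rewrite expf_neq0.
have [r0|r0] := eqVneq r 0.
  move/eqP: E; rewrite r0 expr0n mul0r mulf_eq0 (negbTE (expf_neq0 _ s0)) orbF.
  rewrite E1 mulf_eq0 (negbTE (expf_neq0 _ (serT_neq0 F))) /=.
  by rewrite (negbTE (coefs_neq0 c0)).
have [j [c [cn0 rE]]] := order_factor r0.
exfalso; move: E; rewrite E1 qE sE rE => E.
have /order_uniq : T ^+ ((2 * e).+1 + 2 * o) *
   ((w * u ^+ 2 + T ^+ (2 * f - (2 * e).+1) * v ^+ 2) * t ^+ 2) =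
   T ^+ (2 * j + 2 * f) * (c ^+ 2 * v ^+ 2).
  rewrite (exprD T (2 * e).+1) (exprD T (2 * j)) [LHS]mulrACA [RHS]mulrACA; move: E.
  by rewrite !exprMn -!exprM [(o * 2)%N]mulnC [(j * 2)%N]mulnC [(f * 2)%N]mulnC.
rewrite !coefsM0 !mulf_neq0 // => /(_ isT isT) /(congr1 odd).
by rewrite -addn1 !mul2n !oddD !odd_double.
Qed.

(** No continuity of g is assumed; that g preserves f[[t]] comes from the
    description of f[[t]] by squares. *)
Lemma integral_faut g w y : w 0%N = 1 -> g (tofr T) = tofr (T * w) ->
  integral (g y) <-> integral y.
Proof.
move=> w0 gT; have := @integral_sqr 1 y (coefs1 _ _).
rewrite mulr1 => ->; rewrite (@integral_sqr w) //; split=> -[z zE].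
  exists (faut_inv g z); have := congr1 (faut_inv g) zE.
  by rewrite rmorphD rmorph1 rmorphM -gT !rmorphXn /= !faut_funK.
exists (g z); have := congr1 g zE.
by rewrite rmorphD rmorph1 rmorphM !rmorphXn /= gT.
Qed.

(** As g preserves f[[t]], it maps T^n f[[t]] into itself, and so is determined
    modulo T^n by its value at T. *)
Lemma faut_scomp g w : w 0%N = 1 -> g (tofr T) = tofr (T * w) ->
  forall a, g (tofr a) = tofr (scomp w a).
Proof.
move=> w0 gT a.
have gI b : exists c, g (tofr b) = tofr c.
  by apply/(integral_faut _ w0 gT); exists b.
suff h n : forall a b, g (tofr a) = tofr b -> cong n b (scomp w a).
  by have [b bE] := gI a; rewrite bE; congr tofr; apply: cong_eq => n; apply: h.
elim: n => [|n IH] {}a b; first by move=> _ i.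
rewrite (ser_peel a); set x := a 0%N; set y := sdrop 1 a; have [c cE] := gI y.
rewrite !(rmorphD, rmorphM) /= faut_const gT cE -rmorphM -rmorphD => /tofr_inj <-.
rewrite scompC scompT -!mulrA.
by apply: congD => //; apply: congTS; apply: congM => //; apply: IH.
Qed.

Lemma faut_exists w : w 0%N = 1 -> exists g, g (tofr T) = tofr (T * w).
Proof.
move=> w0; have [k wK kK] := scomp_bij w0.
have kZ : zmod_morphism k := can2_zmod_morphism wK kK.
have kM : monoid_morphism k := can2_monoid_morphism wK kK.
pose kR : {rmorphism ser F -> ser F} :=
  HB.pack k (GRing.isZmodMorphism.Build _ _ k kZ) (GRing.isMonoidMorphism.Build _ _ k kM).
pose wR : {rmorphism ser F -> ser F} := scomp w.
have wi : injective wR := can_inj wK.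
have wK' : cancel wR kR := wK; have kK' : cancel kR wR := kK.
have ki : injective kR := can_inj kK.
have K1 : cancel (fmap wR) (fmap kR).
  move=> x; have [p [q [q0 ->]]] := laurentP x; rewrite (fmapE wi _ q0) (fmapE ki) ?wK' //.
  by move: q0; apply: contraNneq => e; apply/eqP/wi; rewrite e rmorph0.
have K2 : cancel (fmap kR) (fmap wR).
  move=> x; have [p [q [q0 ->]]] := laurentP x; rewrite (fmapE ki _ q0) (fmapE wi) ?kK' //.
  by move: q0; apply: contraNneq => e; apply/eqP/ki; rewrite e rmorph0.
have Cst c : fmap wR (tofr (serC c)) = tofr (serC c).
  by rewrite fmap_tofr //; congr tofr; exact: scompC.
exists (@Faut F (fmap_morph wi) (fmap_morph ki) K1 K2 Cst).
by rewrite /= fmap_tofr //; congr tofr; exact: scompT.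
Qed.

End Integrality.

(** * The groups G_n and their coadjoint action *)
Section Groups.
Variables (F : fieldType) (char0 : [pchar F] =i pred0).
Notation T := (serT F).
Notation D := (@ser_deriv F).
Implicit Types (p q r s a b u w : ser F) (x y : laurent F) (g k : faut F) (M N n : nat).

Fact fautM_const g k c : (g \o k) (tofr (serC c)) = tofr (serC c).
Proof. by rewrite /= !faut_const. Qed.

Definition fautM g k : faut F :=
  @Faut F (g \o k) (faut_inv k \o faut_inv g)
    (can_comp (@faut_funK F g) (@faut_funK F k))
    (can_comp (@faut_invK F k) (@faut_invK F g)) (fautM_const g k).

Definition faut1 : faut F :=
  @Faut F idfun idfun (fun=> erefl) (fun=> erefl) (fun=> erefl).

(** The elements of G_M are the automorphisms g with g(T) = T * dil M u for some
    series u. *)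
Definition dil M u : ser F := 1 + T ^+ M * u.

Lemma dil0 M u : (0 < M)%N -> dil M u 0%N = 1.
Proof. by move=> M0; rewrite coefsD coefsTnM M0 addr0. Qed.

Lemma GP M g : G M g <-> exists u, g (tofr T) = tofr (T * dil M u).
Proof. by split=> -[u uE]; exists u; rewrite uE /dil exprS; congr tofr; ring. Qed.

Lemma sub_G M N g : (M <= N)%N -> G N g -> G M g.
Proof.
move=> le /GP[u uE]; apply/GP; exists (T ^+ (N - M) * u).
by rewrite uE /dil mulrA -exprD subnKC.
Qed.

Lemma G1 M : G M faut1.
Proof. by apply/GP; exists 0; rewrite /= /dil mulr0 addr0 mulr1. Qed.

Lemma G_scomp M g u : (0 < M)%N -> g (tofr T) = tofr (T * dil M u) ->
  forall a, g (tofr a) = tofr (scomp (dil M u) a).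
Proof. by move=> M0 gT; apply: faut_scomp => //; apply: dil0. Qed.

Lemma GM M g k : (0 < M)%N -> G M g -> G M k -> G M (fautM g k).
Proof.
move=> M0 /GP[u gT] /GP[v kT]; apply/GP.
exists (u + dil M u ^+ M.+1 * scomp (dil M u) v).
rewrite /= kT (G_scomp M0 gT); congr tofr.
rewrite !rmorphM /= rmorphD rmorph1 rmorphM rmorphXn /= scompT.
set w := dil M u; set s := scomp w v; rewrite exprMn [w ^+ M.+1]exprS.
transitivity (T * (w + T ^+ M * (w * w ^+ M * s))); first by ring.
by rewrite {1}/w /dil; ring.
Qed.

(** Let w = g(T) / T and let s be the image of w^-1 under the inverse k of g,
    which is integral. Then k(T) = T s, and w^-1 = 1 + T^M v gives
    s = 1 + (T s)^M k(v). *)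
Lemma GV M g : (0 < M)%N -> G M g -> G M (fautV g).
Proof.
move=> M0 /GP[u gT]; set w := dil M u in gT; have w0 : w 0%N = 1 by exact: dil0.
have uw : w \is a GRing.unit by apply: coefs0_unit; rewrite w0 unitr1.
have kI b : exists c, fautV g (tofr b) = tofr c.
  by apply/(integral_faut char0 _ w0 gT); rewrite faut_invK; exists b.
have kw : fautV g (tofr (T * w)) = tofr T by rewrite -gT /= faut_funK.
have [s sE] := kI w^-1; have [c cE] := kI (- (u / w)).
have kT : fautV g (tofr T) = tofr (T * s).
  by rewrite -[T in LHS](mulrK uw) rmorphM rmorphM kw sE rmorphM.
have ww : w^-1 = 1 + T ^+ M * (- (u / w)).
  apply: (mulrI uw); rewrite divrr // mulrDr mulr1.
  rewrite -[w * _]mulrC -!mulrA mulNr -mulrA mulVr // mulr1 mulrN {1}/w /dil; ring.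
apply/GP; exists (s ^+ M * c); rewrite kT; congr (tofr (T * _)).
apply: tofr_inj; rewrite -{1}sE ww !(rmorphD, rmorphM, rmorphXn, rmorph1) /=.
by move: kT cE => /= -> ->; rewrite mulrA -exprMn !rmorphM.
Qed.

Lemma G_exists M u : (0 < M)%N -> exists g, g (tofr T) = tofr (T * dil M u).
Proof. by move=> M0; apply: faut_exists; apply: dil0. Qed.

(** The conjugate by g of the derivation A(T) d/dT is A(h) / h' d/dT, where
    h = g(T); here h = T * dil M u, A = T^(M + 1) a, and T^(M + 1) is divided
    out. *)
Definition adj M u a : ser F := dil M u ^+ M.+1 * scomp (dil M u) a / D (T * dil M u).

Lemma DTdil_unit M u : (0 < M)%N -> D (T * dil M u) \is a GRing.unit.
Proof.
by move=> M0; apply: coefs0_unit; rewrite sderivTM coefsD coefsTM addr0 dil0 ?unitr1.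
Qed.

Lemma vfieldT M b : vfield M b (tofr T) = tofr (T ^+ M.+1 * b).
Proof. by rewrite /vfield ddt_tofr sderivT rmorph1 mulr1. Qed.

Lemma vfield_inj M a b : (forall x, vfield M a x = vfield M b x) -> a = b.
Proof.
move=> /(_ (tofr T)); rewrite !vfieldT => /tofr_inj.
by apply: mulfI; rewrite expf_neq0 ?serT_neq0.
Qed.

(** A derivation a(T) d/dT is determined by its value at T. *)
Lemma Ad_eq M g a b :
  (forall x, vfield M b x = g (vfield M a (fautV g x))) -> Ad M g a = b.
Proof.
move=> bP; apply: (@vfield_inj M) => x; rewrite bP.
exact: (@xgetI _ (0 : ser F) [set b | forall x, vfield M b x = g (vfield M a (fautV g x))] b bP).
Qed.

(** The two derivations agree on fractions by the quotient rule, once the chain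
    rule has turned D (p(h)) into (D p)(h) h'. *)
Lemma adjP M g u a : (0 < M)%N -> g (tofr T) = tofr (T * dil M u) ->
  forall x, vfield M (adj M u a) x = g (vfield M a (fautV g x)).
Proof.
move=> M0 gT x; have [p [q [q0 yE]]] := laurentP (fautV g x).
rewrite yE; have -> : x = g (tofr p / tofr q) by rewrite -yE /= faut_invK.
have gS := G_scomp M0 gT; set w := dil M u in gT gS *.
have sq0 : scomp w q != 0.
  apply/eqP => e; move/eqP: q0; apply; apply: tofr_inj; apply: (fmorph_inj g).
  by rewrite gS e !rmorph0.
rewrite /vfield (fmorph_div g) /= !gS ddtE // ddtE // (rmorphM g) (fmorph_div g) /= !gS.
rewrite [scomp w (q ^+ 2)]rmorphXn !mulrA -!rmorphM; congr (tofr _ / _).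
rewrite /= !(rmorphM, rmorphB, rmorphXn) /= scompT !chain_rule /adj -/w exprMn.
have uD := DTdil_unit u M0; rewrite -/w in uD.
set h := D (T * w) in uD *.
transitivity (T ^+ M.+1 * w ^+ M.+1 * scomp w a *
  (scomp w (D p) * scomp w q - scomp w p * scomp w (D q)) * (h^-1 * h)); first by ring.
by rewrite mulVr // mulr1.
Qed.

Lemma AdE M g u a : (0 < M)%N -> g (tofr T) = tofr (T * dil M u) ->
  Ad M g a = adj M u a.
Proof. by move=> M0 gT; apply: Ad_eq; apply: adjP. Qed.

Lemma AdP M g a : (0 < M)%N -> G M g ->
  forall x, vfield M (Ad M g a) x = g (vfield M a (fautV g x)).
Proof. by move=> M0 /GP[u gT] x; rewrite (AdE _ M0 gT); apply: adjP. Qed.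

Lemma AdM M g k a : (0 < M)%N -> G M g -> G M k ->
  Ad M (fautM g k) a = Ad M g (Ad M k a).
Proof. by move=> M0 Gg Gk; apply: Ad_eq => x; rewrite AdP // AdP. Qed.

Lemma Ad1 M a : Ad M faut1 a = a.
Proof. exact: Ad_eq. Qed.

Lemma adj_lin M u c a b : adj M u (serC c * a + b) = serC c * adj M u a + adj M u b.
Proof. by rewrite /adj rmorphD rmorphM /= scompC; ring. Qed.

Lemma cong_adj M u n a b : cong n a b -> cong n (adj M u a) (adj M u b).
Proof. by move=> h; do 2!apply: congM => //; apply: cong_scomp. Qed.

(** A variant of [lfunE] for a map whose linearity is known only as a
    hypothesis. *)
Lemma linfunE (V W : vectType F) (f : V -> W) : linear f -> linfun f =1 f.
Proof.
move=> lf; pose fL : {linear V -> W} := HB.pack f (GRing.isLinear.Build F V W _ f lf).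
exact: (lfunE fL).
Qed.

Lemma LprojK M N (x : L F M N) : Lproj M N (Lsect x) = x.
Proof. by apply/rowP => j; rewrite !mxE /= valK. Qed.

Lemma LsectK M N a : cong (N - M) (Lsect (Lproj M N a)) a.
Proof. by move=> i lt; rewrite /= insubT mxE. Qed.

Lemma Lproj_lin M N c a b :
  Lproj M N (serC c * a + b) = c *: Lproj M N a + Lproj M N b.
Proof. by apply/rowP => j; rewrite !mxE coefsD coefsCM. Qed.

Lemma Lsect_lin M N c (x y : L F M N) : Lsect (c *: x + y) = serC c * Lsect x + Lsect y.
Proof.
apply: serP => i; rewrite coefsD coefsCM /=; case: insub => [j|]; rewrite ?mxE //.
by rewrite mulr0 addr0.
Qed.

Lemma eq_Lproj M N a b : cong (N - M) a b -> Lproj M N a = Lproj M N b.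
Proof. by move=> h; apply/rowP => j; rewrite !mxE h. Qed.

Lemma Ldual_eq M N (v w : Ldual F M N) :
  (forall a, v (Lproj M N a) = w (Lproj M N a)) -> v = w.
Proof. by move=> h; apply/lfunP => x; rewrite -[x]LprojK h. Qed.

Lemma coadq_proj M N g (v : Ldual F M N) a : (0 < M)%N -> G M g ->
  coadq g v (Lproj M N a) = v (Lproj M N (Ad M (fautV g) a)).
Proof.
move=> M0 Gg; have /GP[u gT] := GV M0 Gg.
rewrite /coadq linfunE.
  rewrite /Adq !(AdE _ M0 gT); congr (v _); apply: eq_Lproj; apply: cong_adj.
  exact: LsectK.
by move=> c x y; rewrite /Adq !(AdE _ M0 gT) Lsect_lin adj_lin Lproj_lin linearP.
Qed.

Lemma coadqM M N g k (v : Ldual F M N) : (0 < M)%N -> G M g -> G M k ->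
  coadq (fautM g k) v = coadq g (coadq k v).
Proof.
move=> M0 Gg Gk; apply: Ldual_eq => a; rewrite !coadq_proj //; last exact: GM.
by have <- := AdM a M0 (GV M0 Gk) (GV M0 Gg).
Qed.

Lemma coadq1 M N (v : Ldual F M N) : (0 < M)%N -> coadq faut1 v = v.
Proof.
move=> M0; apply: Ldual_eq => a; rewrite coadq_proj //; last exact: G1.
by rewrite -[in RHS](Ad1 M a).
Qed.

Lemma coadqK M N g (v : Ldual F M N) : (0 < M)%N -> G M g ->
  coadq (fautV g) (coadq g v) = v.
Proof.
move=> M0 Gg; apply: Ldual_eq => a; have GVg := GV M0 Gg.
rewrite !coadq_proj //; congr (v (Lproj _ _ _)); apply: (@vfield_inj M) => x.
by rewrite (AdP _ M0 GVg) (AdP _ M0 (GV M0 GVg)) /= !faut_funK.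
Qed.

(** The orbits of G_M itself: they are those of G_{MN} by [is_orbitqE], since the
    classes of G_{MN} cover G_M. *)
Definition orbq M N (v : Ldual F M N) : set (Ldual F M N) :=
  [set w | exists2 g, G M g & w = coadq g v].

Lemma is_orbitqE M N O : (0 < M)%N -> (M <= N)%N ->
  is_orbitq O <-> exists v : Ldual F M N, O = orbq v.
Proof.
move=> M0 le; suff E (v : Ldual F M N) :
   [set w | exists2 C, Gq M N C & exists2 g, C g & w = coadq g v] = orbq v.
  by split=> -[v vE]; exists v; rewrite vE E.
apply/seteqP; split=> w /=.
  move=> [_ [g Gg ->] [h [k Gk hE] ->]]; exists h => //.
  have [u uE] := (GP M _).1 (GM M0 Gg (sub_G le Gk)).
  by apply/GP; exists u; rewrite hE.
move=> [g Gg ->]; exists [set h : faut F | exists2 k, G N k & forall x, h x = g (k x)].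
  by exists g.
by exists g => //; exists faut1 => //; apply: G1.
Qed.

Lemma orbq_refl M N (v : Ldual F M N) : (0 < M)%N -> orbq v v.
Proof. by move=> M0; exists faut1; rewrite ?coadq1 //; apply: G1. Qed.

Lemma orbq_eq M N (v w : Ldual F M N) : (0 < M)%N -> orbq v w -> orbq w = orbq v.
Proof.
move=> M0 [g Gg ->]; apply/seteqP; split=> _ [k Gk ->].
  by exists (fautM k g); rewrite ?coadqM //; apply: GM.
exists (fautM k (fautV g)); first by apply: GM => //; apply: GV.
by rewrite coadqM ?coadqK //; apply: GV.
Qed.

End Groups.

(** * Change of variable in quadratic differentials *)
Section QuadraticDifferentials.
Variables (F : fieldType) (char0 : [pchar F] =i pred0).
Notation T := (serT F).
Notation D := (@ser_deriv F).
Implicit Types (a b c u w phi psi : ser F).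

(** The residue pairing modulo T^(d + 1) is perfect. *)
Lemma coef_pair_cong d a b : (forall c, (a * c) d = (b * c) d) -> cong d.+1 a b.
Proof.
move=> h i; rewrite ltnS => le; have := h (T ^+ (d - i) * 1).
rewrite !mulr1 ![_ * T ^+ _]mulrC !coefsTnM ltnNge leq_subr /=.
by rewrite subKn.
Qed.

Lemma cong_dil_pow s u k : (0 < s)%N ->
  cong s.+1 (dil s u ^+ k) (1 + T ^+ s * (k%:R * u)).
Proof.
move=> s0; elim: k => [|k IH].
  by rewrite mul0r mulr0 addr0.
rewrite exprS; apply: (cong_trans (congM (@cong_refl _ _ _) IH)).
have -> : dil s u * (1 + T ^+ s * (k%:R * u)) =
    (1 + T ^+ s * (k.+1%:R * u)) + T ^+ s * (T ^+ s * (k%:R * u ^+ 2)).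
  by rewrite /dil -natr1; ring.
rewrite -[X in cong _ _ X]addr0; apply: congD => //.
rewrite mulrA -exprD; apply: congW (congTn0 _); lia.
Qed.

Lemma D_dil s u : (0 < s)%N -> D (T * dil s u) = dil s (s.+1%:R * u + T * D u).
Proof.
case: s => // s _; rewrite sderivTM /dil sderivD sderivM sderivX sderivT.
rewrite -(rmorph1 (@serC F)) sderivC rmorph1 /= [T ^+ s.+1]exprS -[s.+2%:R]natr1; ring.
Qed.

(** The substitution T |-> T + u_0 T^(s + 1) + ... multiplies the quadratic
    differential T^-(n + 2) dT^2 by 1 + (2 s - n) u_0 T^s + ... or by its inverse,
    according to its direction. So its effect on phi starts at the coefficient of
    index s, and there it is a translation by a multiple of u_0, unless n = 2 s or
    phi_0 = 0. *)
Lemma shear s d n u phi phi' : (0 < s)%N ->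
  cong d (dil s u ^+ n.+2 * phi) (D (T * dil s u) ^+ 2 * scomp (dil s u) phi') ->
  cong (minn s d) phi phi' /\
  ((s < d)%N -> phi' s = phi s + (n%:R - (2 * s)%:R) * u 0%N * phi 0%N).
Proof.
move=> s0 h; rewrite D_dil // in h; set z := _ + _ in h.
have {}h : cong (minn s.+1 d) (phi + T ^+ s * (n.+2%:R * u * phi))
    (phi' + T ^+ s * (2%:R * z * phi')).
  have E k x y : y + T ^+ s * (k%:R * x * y) = (1 + T ^+ s * (k%:R * x)) * y by ring.
  have lem : (minn s.+1 d <= s.+1)%N by exact: geq_minl.
  rewrite !E; apply: cong_trans (cong_trans (congW (geq_minr _ _) h) _).
    by apply: congM => //; apply: cong_sym; apply: congW lem _; apply: cong_dil_pow.
  apply: congM; apply: congW lem _; first exact: cong_dil_pow.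
  exact: scomp_near_id.
have low : cong (minn s d) phi phi'.
  move=> i; rewrite leq_min => /andP[lt1 lt2]; have := h i.
  by rewrite !coefsD !coefsTnM lt1 !addr0; apply; rewrite leq_min lt2 ltnS (ltnW lt1).
split=> // lt; have e0 : phi 0%N = phi' 0%N by apply: low; rewrite leq_min s0; lia.
have := h s; rewrite leq_min ltnSn lt => /(_ isT).
rewrite !coefsD !coefsTnM ltnn subnn !coefsM0 -!(rmorph_nat (@serC F)) /z.
rewrite coefsD coefsM0 coefsTM addr0 -!(rmorph_nat (@serC F)) !coefsC /= -e0.
move=> e; apply: (addIr (2%:R * (s.+1%:R * u 0%N) * phi 0%N)); rewrite -e.
rewrite -!natr1 natrM; ring.
Qed.

(** The square root of a quadratic differential is a differential, and the
    residue of a differential is invariant. In degree n = 2 p, the residue of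
    T^-(p + 1) psi(T) dT is the coefficient of index p of psi. *)
Lemma residue_sqrt_invariance d p w phi phi' psi psi' (c : F) :
  w 0%N = 1 -> psi 0%N = 1 -> psi' 0%N = 1 -> c != 0 -> (p < d)%N ->
  cong d (serC c * (psi * psi)) phi -> cong d (serC c * (psi' * psi')) phi' ->
  cong d (w ^+ (2 * p).+2 * phi) (D (T * w) ^+ 2 * scomp w phi') ->
  psi p = psi' p.
Proof.
move=> w0 a0 b0 c0 lt ha hb h.
have uw : w \is a GRing.unit by apply: coefs0_unit; rewrite w0 unitr1.
have uc : serC c \is a GRing.unit by apply: coefs0_unit; rewrite coefsC unitfE.
have u2 := unit2 char0.
have D0 : D (T * w) 0%N = 1 by rewrite sderivTM coefsD coefsTM addr0.
have {}h : cong d (w ^+ p.+1 * psi) (D (T * w) * scomp w psi').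
  apply: (cong_sqr u2).
  - by rewrite coefsM0 coefsX0 w0 expr1n mul1r.
  - by rewrite coefsM0 D0 scomp0 mul1r.
  apply: (cong_unitl uc).
  have -> : serC c * (w ^+ p.+1 * psi * (w ^+ p.+1 * psi)) =
            w ^+ (2 * p).+2 * (serC c * (psi * psi)).
    by rewrite !exprS mulnC exprM; ring.
  have -> : serC c * (D (T * w) * scomp w psi' * (D (T * w) * scomp w psi')) =
            D (T * w) ^+ 2 * scomp w (serC c * (psi' * psi')).
    by rewrite !rmorphM /= scompC; ring.
  apply: cong_trans (congM (@cong_refl _ _ _) ha) (cong_trans h _).
  by apply: congM => //; apply: cong_scomp; apply: cong_sym.
rewrite -(residue_invariance char0 w0 p psi').
have -> : psi p = (w^-1 ^+ p.+1 * (w ^+ p.+1 * psi)) p.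
  by rewrite mulrA -exprMn mulVr // expr1n mul1r.
by rewrite -mulrA; apply: congM lt => //; apply: h.
Qed.

End QuadraticDifferentials.

(** * Linear forms as quadratic differentials *)
Section Forms.
Variables (F : fieldType) (char0 : [pchar F] =i pred0) (m n : nat) (lt_mn : (m < n)%N).
Notation T := (serT F).
Notation D := (@ser_deriv F).
Notation V := (Ldual F m.+1 n.+1).
Implicit Types (a b c u w phi psi : ser F) (v : V).

(** The coordinates of v from the top down: the coefficient of T^i is l_(n-i).
    The linear form v is the residue pairing of vector fields with the quadratic
    differential T^-(n + 2) (qform v) dT^2, which matters modulo T^-(m + 2). *)
Definition qform v : ser F := Ser (fun i => if (i < n - m)%N then ell (n - i) v else 0).

Lemma qformE v i : (i < n - m)%N -> qform v i = ell (n - i) v.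
Proof. by move=> lt; rewrite /qform /= lt. Qed.

Lemma pairE v a : v (Lproj m.+1 n.+1 a) = (qform v * a) (n - m).-1.
Proof.
have d0 : (0 < n - m)%N by rewrite subn_gt0.
have -> : Lproj m.+1 n.+1 a =
    \sum_(j < n - m) a j *: (\row_(i < n - m) (m.+1 + i == m.+1 + j)%N%:R).
  apply/rowP => i; rewrite !mxE summxE (bigD1 i) //= !mxE eqxx mulr1 big1 ?addr0 //.
  by move=> j ne; rewrite !mxE eqn_add2l eq_sym val_eqE (negbTE ne) mulr0.
rewrite linear_sum coefsM prednK // (reindex_inj rev_ord_inj).
apply: eq_bigr => i _; rewrite linearZ qformE ?ltn_ord // [RHS]mulrC.
have lt := ltn_ord i; congr (_ * _); [congr (a _) | congr (ell _ v)].
  by rewrite /=; lia.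
by rewrite /=; lia.
Qed.

Lemma qform_inj v v' : cong (n - m) (qform v) (qform v') -> v = v'.
Proof.
move=> h; apply: Ldual_eq => a; rewrite !pairE; apply: congM h _ _ _ => //.
by rewrite prednK // subn_gt0.
Qed.

Lemma qform_surj phi : exists v, cong (n - m) (qform v) phi.
Proof.
have d0 : (0 < n - m)%N by rewrite subn_gt0.
pose f (x : L F m.+1 n.+1) : F^o := (phi * Lsect x) (n - m).-1.
have fL : linear f.
  by move=> c x y; rewrite /f Lsect_lin mulrDr coefsD mulrCA coefsCM.
exists (linfun f) => i lt; rewrite qformE // /ell linfunE // /f.
have <- : (phi * (T ^+ ((n - m).-1 - i) * 1)) (n - m).-1 = phi i.
  rewrite mulr1 mulrC coefsTnM ltnNge leq_subr /= subKn //; lia.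
apply: congM (_ : cong (n - m) _ _) _ _ => //; last by rewrite prednK.
move=> j ltj; rewrite coefsTnM coefs1 /= insubT mxE /=.
case: ltnP => l1; last case: eqP => l2; case: eqP => // l3; lia.
Qed.

(** The group acts on quadratic differentials by change of variable. This is read
    off the residue pairing with A(h) / h' d/dT: invariance of residues moves the
    substitution to the other factor, and the pairing is perfect because every
    series is of the form c(h). *)
Lemma transformation_law g v : G m.+1 g -> exists u,
  fautV g (tofr T) = tofr (T * dil m.+1 u) /\
  cong (n - m) (dil m.+1 u ^+ n.+2 * qform v)
     (D (T * dil m.+1 u) ^+ 2 * scomp (dil m.+1 u) (qform (coadq g v))).
Proof.
move=> Gg; have /GP[u gT] := GV char0 (ltn0Sn m) Gg; exists u; split=> //.
have d0 : (0 < n - m)%N by rewrite subn_gt0.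
set w := dil m.+1 u in gT *; have w0 : w 0%N = 1 by apply: dil0.
have uw : w \is a GRing.unit by apply: coefs0_unit; rewrite w0 unitr1.
have uD : D (T * w) \is a GRing.unit by apply: DTdil_unit.
have [k _ kK] := scomp_bij w0.
have : cong (n - m) (qform v * w ^+ m.+2 / D (T * w))
    (w^-1 ^+ (n - m) * D (T * w) * scomp w (qform (coadq g v))).
  rewrite -(prednK d0); apply: coef_pair_cong => c.
  rewrite -[c]kK -(mulrA _ (scomp w _) (scomp w _)) -rmorphM residue_invariance //.
  rewrite -pairE coadq_proj // (AdE char0 _ _ gT) // pairE /adj -/w.
  congr ((_ : ser F) _); ring.
move=> /(congM (@cong_refl _ (n - m) (w ^+ (n - m) * D (T * w)))).
have -> : w ^+ (n - m) * D (T * w) * (qform v * w ^+ m.+2 / D (T * w)) =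
   w ^+ (n - m + m.+2) * qform v * (D (T * w) / D (T * w)) by rewrite exprD; ring.
have -> : w ^+ (n - m) * D (T * w) * (w^-1 ^+ (n - m) * D (T * w) * scomp w (qform (coadq g v))) =
   (w * w^-1) ^+ (n - m) * (D (T * w) ^+ 2 * scomp w (qform (coadq g v))).
  by rewrite exprMn; ring.
rewrite !divrr // mulr1 expr1n mul1r.
by have -> : (n - m + m.+2 = n.+2)%N by lia.
Qed.

Lemma orbq_shear g v : G m.+1 g ->
  cong (minn m.+1 (n - m)) (qform v) (qform (coadq g v)) /\
  (n = 2 * m + 2 -> qform (coadq g v) m.+1 = qform v m.+1)%N.
Proof.
move=> Gg; have [u [_ law]] := transformation_law v Gg.
have [low top] := shear (ltn0Sn m) law; split=> // nE; rewrite top; last lia.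
have -> : (2 * m.+1 = n)%N by lia.
by rewrite subrr !mul0r addr0.
Qed.

Lemma orbq_low v v' : orbq v v' -> cong (minn m.+1 (n - m)) (qform v) (qform v').
Proof. by move=> [g Gg ->]; case: (orbq_shear v Gg). Qed.

Lemma orbq_qform0 v v' : orbq v v' -> qform v 0%N = qform v' 0%N.
Proof. by move/orbq_low; apply; rewrite leq_min subn_gt0. Qed.

(** Only the coefficient of index m + 1 could move, and it exists only if
    n = 2 m + 2, when it is the middle one. *)
Lemma orbq_point v v' : (n <= 2 * m + 2)%N -> orbq v v' -> v' = v.
Proof.
move=> le [g Gg ->]; have [low top] := orbq_shear v Gg; apply: qform_inj => i lt.
have [lti|lei] := ltnP i m.+1; first by rewrite low // leq_min lti.
have -> : i = m.+1 by lia.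
by apply: top; lia.
Qed.

Lemma orbq_normal_sqrt p v v' : n = (2 * p)%N -> (m < p)%N -> qform v 0%N != 0 ->
  orbq v v' -> normal_sqrt (qform v) p = normal_sqrt (qform v') p.
Proof.
move=> nE lt v0 O; have e0 := orbq_qform0 O; case: O => g Gg v'E.
have [a0 a1] := normal_sqrtP char0 v0; have [|b0 b1] := normal_sqrtP char0 (phi := qform v').
  by rewrite -e0.
have nE2 : n.+2 = (2 * p).+2 by rewrite -nE.
have [u [_]] := transformation_law v Gg; rewrite -v'E nE2.
apply: (@residue_sqrt_invariance _ char0 (n - m) p _ _ _ _ _ (qform v 0%N)) => //.
- exact: dil0.
- by lia.
- by rewrite a1.
- by rewrite e0 b1.
Qed.

(** The coefficients of index m + 1, m + 2, ... are adjusted in turn: a shear of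
    order s translates the coefficient of index s and leaves the earlier ones
    alone. The middle coefficient, which cannot be moved, already has the required
    value, because the invariant residue determines it from the earlier ones. *)
Lemma orbq_transitive v v' : (2 * m + 2 < n)%N -> qform v 0%N != 0 ->
  cong m.+1 (qform v) (qform v') ->
  (forall p, n = (2 * p)%N -> normal_sqrt (qform v) p = normal_sqrt (qform v') p) ->
  orbq v v'.
Proof.
move=> lt2 v0 low psiE; have M0 : (0 < m.+1)%N by [].
suff [v1 O h] : exists2 v1, orbq v v1 & cong (n - m) (qform v1) (qform v').
  by rewrite -(qform_inj h).
suff H s : (m.+1 + s <= n - m)%N ->
    exists2 v1, orbq v v1 & cong (m.+1 + s)%N (qform v1) (qform v').
  by have := H (n - m - m.+1)%N; rewrite subnKC; [apply; lia|lia].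
(* The forms v1 and v' agree below the index m + 1 + s, where they are now made to
   agree. *)
elim: s => [|s IH] les; first by exists v; [exact: orbq_refl|rewrite addn0].
have [|v1 O1 h1] := IH; first lia.
have e0 := orbq_qform0 O1; have v10 : qform v1 0%N != 0 by rewrite -e0.
have step v2 : cong (m.+1 + s)%N (qform v2) (qform v') ->
    qform v2 (m.+1 + s)%N = qform v' (m.+1 + s)%N ->
    cong (m.+1 + s.+1)%N (qform v2) (qform v').
  move=> h e i; rewrite addnS ltnS leq_eqVlt => /orP[/eqP->//|]; exact: h.
have [nE|nE] := eqVneq n (2 * (m.+1 + s))%N.
  exists v1 => //; apply: (step _ h1).
  have v'0 : qform v' 0%N != 0 by rewrite -h1.
  have [a0 a1] := normal_sqrtP char0 v10; have [b0 b1] := normal_sqrtP char0 v'0.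
  have e01 : qform v1 0%N = qform v' 0%N by apply: h1.
  have pE : normal_sqrt (qform v1) (m.+1 + s)%N = normal_sqrt (qform v') (m.+1 + s)%N.
    by rewrite -psiE // -(orbq_normal_sqrt nE _ v0 O1) //; lia.
  have cpsi : cong (m.+1 + s)%N (normal_sqrt (qform v1)) (normal_sqrt (qform v')).
    apply: (cong_sqr (unit2 char0) a0 b0).
    apply: (@cong_unitl _ (serC (qform v1 0%N))).
      by apply: coefs0_unit; rewrite coefsC unitfE.
    by rewrite a1 e01 b1.
  rewrite -[in LHS]a1 -[in RHS]b1 !coefsCM e01; congr (_ * _).
  by apply/eqP; rewrite -subr_eq0 (coefs_sqr a0 b0 cpsi) pE subrr mulr0.
have nE0 : (n%:R - (2 * (m.+1 + s))%:R : F) != 0.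
  by rewrite subr_eq0; apply: contra_neq nE; apply: natr_inj.
pose c := (qform v' (m.+1 + s)%N - qform v1 (m.+1 + s)%N) /
   ((n%:R - (2 * (m.+1 + s))%:R) * qform v1 0%N).
have [k kT] := G_exists (T ^+ s * serC c) M0.
have Gk : G m.+1 k by apply/GP; exists (T ^+ s * serC c).
pose g := fautV k; have Gg : G m.+1 g by apply: GV.
have [u [gT law]] := transformation_law v1 Gg.
have dE : dil m.+1 u = dil (m.+1 + s) (serC c).
  have : tofr (T * dil m.+1 u) = tofr (T * dil m.+1 (T ^+ s * serC c)) :> laurent F.
    by rewrite -gT -kT.
  move/tofr_inj/(mulfI (serT_neq0 F)) => ->; by rewrite /dil mulrA -exprD.
rewrite dE in law; have [|l1 l2] := shear _ law; first lia.
exists (coadq g v1).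
  by rewrite -(orbq_eq char0 M0 O1); exists g.
apply: step.
  move=> i lti; rewrite -h1 // -l1 // leq_min lti; lia.
rewrite l2; last lia.
rewrite coefsC /= mulrAC [_ * c]mulrC divfK ?mulf_neq0 //.
by rewrite addrC subrK.
Qed.

End Forms.

(** * The values of the polynomials P_mk *)
Section PmkEval.
Variables (F : fieldType) (char0 : [pchar F] =i pred0) (m k : nat).
Notation R := {mpoly F[(m + k).+1]}.

Let u2 := unit2 char0.

Let u2R : (2%:R : R) \is a GRing.unit.
Proof.
apply/unitrP; exists (2%:R^-1)%:MP.
by rewrite -[2%:R : R](rmorph_nat (@mpolyC _ F)) -!rmorphM /= mulVr // mulrV.
Qed.

Lemma xseries0 r : xseries F m k r 0%N = 1. Proof. by []. Qed.

(** The difference of the square roots A and B in the definition of P_mk equals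
    (A^2 - B^2) / (A + B), where x_0^m divides A^2 - B^2 and A + B is
    invertible. *)
Lemma Pmk_specP : @Pmk_spec F m k (Pmk F m k).
Proof.
set x0 : R := 'X_(inord 0).
have [a0 aa] := ser_sqrtP u2R (xseries0 (m + k)); have [b0 bb] := ser_sqrtP u2R (xseries0 m).
set A := ser_sqrt _ in a0 aa; set B := ser_sqrt _ in b0 bb.
pose E : ser R := Ser (fun i => if (m < i <= m + k)%N then 'X_(inord i) * x0 ^+ (i.-1 - m) else 0).
have uAB : A + B \is a GRing.unit by apply: unit_sum1.
have AB : A - B = serC (x0 ^+ m) * (E / (A + B)).
  apply: (mulIr uAB); rewrite -!mulrA mulVr // mulr1.
  have -> : (A - B) * (A + B) = A * A - B * B by ring.
  rewrite aa bb; apply: serP => i; rewrite coefsCM coefsB /=.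
  case: eqP => [->|/eqP i0]; first by rewrite subrr mulr0.
  have [le1|gt1] := leqP i m; first by rewrite (leq_trans le1 (leq_addr _ _)) subrr mulr0.
  case: leqP => le2; last by rewrite subrr mulr0.
  rewrite subr0 mulrCA -exprD subnKC //; lia.
have eP : @Pmk_spec F m k ((E / (A + B)) (m + k)%N).
  change (x0 ^+ m * (E / (A + B)) (m + k)%N = (A - B) (m + k)%N).
  by rewrite AB coefsCM.
exact: (@xgetI _ (0 : R) (@Pmk_spec F m k) _ eP).
Qed.

Definition smap (S S' : comNzRingType) (f : S -> S') (a : ser S) : ser S' := Ser (fun i => f (a i)).

Lemma smapM (S S' : comNzRingType) (f : {rmorphism S -> S'}) (a b : ser S) :
  smap f (a * b) = smap f a * smap f b.
Proof.
apply: serP => i; rewrite !coefsM [LHS]rmorph_sum /=.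
by apply: eq_bigr => j _; rewrite rmorphM.
Qed.

(** The series a(c T). *)
Definition sscale (c : F) (a : ser F) : ser F := Ser (fun i => c ^+ i * a i).

Lemma sscaleM c a b : sscale c (a * b) = sscale c a * sscale c b.
Proof.
apply: serP => i; rewrite !coefsM [LHS]mulr_sumr.
apply: eq_bigr => j _ /=; rewrite mulrACA -exprD subnKC // -ltnS; exact: ltn_ord.
Qed.

(** If x_0 psi^2 = x_0 + x_1 T + x_2 T^2 + ..., then psi(x_0 T)^2 is the series
    under the square root in the definition of P_mk. *)
Lemma eval_sqrt_xseries (y : 'I_(m + k).+1 -> F) r (psi : ser F) :
  let x0 := y (inord 0) in
  x0 != 0 -> psi 0%N = 1 ->
  cong (m + k).+1 (serC x0 * (psi * psi))
      (Ser (fun i => if (i <= r)%N then y (inord i) else 0)) ->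
  (ser_sqrt (xseries F m k r) (m + k)%N).@[y] = x0 ^+ (m + k) * psi (m + k)%N.
Proof.
move=> x0 x0n psi0 h; have [a0 aa] := ser_sqrtP u2R (xseries0 r).
set A := ser_sqrt _ in a0 aa *.
suff /(_ _ (ltnSn (m + k)%N)) : cong (m + k).+1 (smap (meval y) A) (sscale x0 psi) by [].
apply: (cong_sqr u2).
- by rewrite /smap /= a0 rmorph1.
- by rewrite /sscale /= psi0 expr0 mulr1.
rewrite -sscaleM -smapM aa => i lt.
have := h i lt; rewrite coefsCM /sscale /smap [coefs (Ser _) _]/= [coefs (Ser _) _]/=.
move=> e; rewrite /=; apply: (mulfI x0n); rewrite mulrCA -/(_ * _) e.
case: eqP => [->|/eqP i0] /=; first by rewrite rmorph1 expr0 mul1r mulr1.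
case: leqP => le; last by rewrite rmorph0 !mulr0.
rewrite rmorphM rmorphXn /= !mevalXU -/x0 mulrCA [RHS]mulrC; congr (_ * _).
by case: i i0 {lt e le} => // i _; rewrite exprS.
Qed.

Lemma Pmk_eval (y : 'I_(m + k).+1 -> F) (psi psim : ser F) :
  let x0 := y (inord 0) in
  x0 != 0 -> psi 0%N = 1 -> psim 0%N = 1 ->
  cong (m + k).+1 (serC x0 * (psi * psi))
      (Ser (fun i => if (i <= m + k)%N then y (inord i) else 0)) ->
  cong (m + k).+1 (serC x0 * (psim * psim))
      (Ser (fun i => if (i <= m)%N then y (inord i) else 0)) ->
  x0 ^+ m * (Pmk F m k).@[y] = x0 ^+ (m + k) * (psi (m + k)%N - psim (m + k)%N).
Proof.
move=> x0 x0n a0 b0 ha hb.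
have sp : 'X_(inord 0) ^+ m * Pmk F m k = ser_sqrt (xseries F m k (m + k)) (m + k)%N -
  ser_sqrt (xseries F m k m) (m + k)%N := Pmk_specP.
have e1 : ('X_(inord 0) ^+ m : R).@[y] = x0 ^+ m by rewrite rmorphXn /= mevalXU.
have := congr1 (meval y) sp; rewrite mevalM e1 => ->.
by rewrite mevalB (eval_sqrt_xseries x0n a0 ha) (eval_sqrt_xseries x0n b0 hb) mulrBr.
Qed.

(** The difference quotient of P_mk in its last variable is x_0^(k - 1) / 2. *)
Lemma Pmk_linear (y y' : 'I_(m + k).+1 -> F) : (0 < k)%N -> y (inord 0) != 0 ->
  (forall j, j != ord_max -> y j = y' j) ->
  2%:R * y (inord 0) ^+ m.+1 * ((Pmk F m k).@[y] - (Pmk F m k).@[y']) =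
  y (inord 0) ^+ (m + k) * (y ord_max - y' ord_max).
Proof.
move=> k0 y0 yy; pose tr r (z : 'I_(m + k).+1 -> F) : ser F :=
  Ser (fun i => if (i <= r)%N then z (inord i) else 0).
have yyi i : (i < m + k)%N -> y (inord i) = y' (inord i).
  move=> lt; apply: yy; rewrite -val_eqE /= inordK; lia.
have e0 : y (inord 0) = y' (inord 0) by apply: yyi; lia.
have y'0 : y' (inord 0) != 0 by rewrite -e0.
have [a0 ha] := normal_sqrtP char0 (phi := tr (m + k)%N y) y0.
have [b0 hb] := normal_sqrtP char0 (phi := tr (m + k)%N y') y'0.
have [c0 hc] := normal_sqrtP char0 (phi := tr m y) y0.
set psi := normal_sqrt _ in a0 ha; set psi' := normal_sqrt _ in b0 hb.
set psim := normal_sqrt _ in c0 hc.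
have low : cong (m + k) psi psi'.
  apply: (cong_sqr u2) => //; apply: (@cong_unitl _ (serC (y (inord 0)))).
    by apply: coefs0_unit; rewrite coefsC unitfE.
  rewrite [X in cong _ _ (serC X * _)]e0 [X in cong _ X]ha [X in cong _ _ X]hb.
  by move=> i lt; rewrite /= yyi.
have Ey : y (inord 0) ^+ m * (Pmk F m k).@[y] =
    y (inord 0) ^+ (m + k) * (psi (m + k)%N - psim (m + k)%N).
  by apply: Pmk_eval => //; [rewrite [serC _ * _]ha|rewrite [serC _ * _]hc].
have Ey' : y' (inord 0) ^+ m * (Pmk F m k).@[y'] =
    y' (inord 0) ^+ (m + k) * (psi' (m + k)%N - psim (m + k)%N).
  apply: Pmk_eval => //; first by rewrite [serC _ * _]hb.
  rewrite -e0 [serC _ * _]hc => i _ /=; case: leqP => // le; apply: yyi; lia.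
have -> : 2%:R * y (inord 0) ^+ m.+1 * ((Pmk F m k).@[y] - (Pmk F m k).@[y']) =
  2%:R * y (inord 0) * (y (inord 0) ^+ m * (Pmk F m k).@[y] - y' (inord 0) ^+ m * (Pmk F m k).@[y']).
  by rewrite -e0 exprS; ring.
rewrite Ey Ey' -e0.
have mE : (inord (m + k) : 'I_(m + k).+1) = ord_max by apply: val_inj; rewrite /= inordK.
have h1 : (serC (y (inord 0)) * (psi * psi)) (m + k)%N = y ord_max.
  by rewrite [serC _ * _]ha /= leqnn mE.
have h2 : (serC (y' (inord 0)) * (psi' * psi')) (m + k)%N = y' ord_max.
  by rewrite [serC _ * _]hb /= leqnn mE.
rewrite -h1 -h2 !coefsCM -e0 -[in RHS]mulrBr (coefs_sqr a0 b0 low); ring.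
Qed.

End PmkEval.

(** * Polynomial functions and parametrized varieties *)
Section InfiniteField.
Variables (F : fieldType) (char0 : [pchar F] =i pred0).

Lemma poly_fun_eq0 (p : {poly F}) : (forall t, p.[t] = 0) -> p = 0.
Proof.
move=> p0; apply: (@roots_geq_poly_eq0 _ p [seq i%:R | i <- iota 0 (size p)]).
- by apply/allP => t _; apply/rootP.
- by rewrite map_inj_uniq ?iota_uniq // => i j; apply: natr_inj.
- by rewrite size_map size_iota.
Qed.

Lemma digits_inj (B r : nat) (f g : nat -> nat) :
  (forall i, (i < r)%N -> (f i < B)%N /\ (g i < B)%N) ->
  (\sum_(0 <= i < r) f i * B ^ i = \sum_(0 <= i < r) g i * B ^ i)%N ->
  forall i, (i < r)%N -> f i = g i.
Proof.
elim: r f g => // r IH f g lt; rewrite !big_nat_recl // !expn0 !muln1 => e.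
have sE h : (\sum_(0 <= i < r) h i.+1 * B ^ i.+1 = (\sum_(0 <= i < r) h i.+1 * B ^ i) * B)%N.
  by rewrite big_distrl; apply: eq_bigr => i _; rewrite expnS mulnCA mulnC.
rewrite !sE in e; have [lf lg] := lt 0%N isT; have B0 : (0 < B)%N by exact: leq_trans lf.
have e0 : f 0%N = g 0%N.
  by have := congr1 (modn^~ B) e; rewrite ![(_ + _ * B)%N]addnC !modnMDl !modn_small.
case=> [|i] // lti; apply: (IH (fun i => f i.+1) (fun i => g i.+1)) => //.
  by move=> j ltj; apply: lt.
by move: e; rewrite e0 => /addnI/eqP; rewrite eqn_pmul2r // => /eqP.
Qed.

(** Kronecker's substitution v_i = t^(B^i), for B greater than all exponents,
    sends distinct monomials to distinct powers of t. *)
Lemma meval_eq0 r (q : {mpoly F[r]}) : (forall v, q.@[v] = 0) -> q = 0.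
Proof.
move=> q0; pose B := msize q.
pose e (M : 'X_{1..r}) := (\sum_(i < r) M i * B ^ i)%N.
pose P : {poly F} := \sum_(M <- msupp q) q@_M *: 'X^(e M).
have P0 : P = 0.
  apply: poly_fun_eq0 => t; rewrite -(q0 (fun i => t ^+ (B ^ i))) mevalE horner_sum.
  apply: eq_bigr => M _; rewrite hornerZ hornerXn /e; congr (_ * _).
  rewrite expr_sum; apply: eq_bigr => i _; by rewrite mulnC exprM.
have bound M (i : 'I_r) : M \in msupp q -> (M i < B)%N.
  by move/msize_mdeg_lt; apply: leq_ltn_trans; rewrite mdegE (bigD1 i) //= leq_addr.
apply/mpolyP => M; rewrite mcoeff0; apply/eqP; rewrite mcoeff_eq0; apply/negP => Ms.
have /eqP := congr1 (fun p : {poly F} => p`_(e M)) P0.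
rewrite coef0 coef_sum (bigD1_seq M) ?msupp_uniq //= coefZ coefXn eqxx mulr1.
rewrite big_seq_cond big1 ?addr0; first by apply/negP; rewrite -mcoeff_msupp.
move=> M' /andP[M's neM]; rewrite coefZ coefXn; case: eqP => [eM|_]; last by rewrite mulr0.
case/eqP: neM; apply/mnmP => i.
pose f (N : 'X_{1..r}) j := if insub j is Some i then N i else 0%N.
have fE N (j : 'I_r) : f N j = N j by rewrite /f valK.
rewrite -!fE; apply: (@digits_inj B r); rewrite ?ltn_ord //.
  by move=> j ltj; rewrite /f insubT !bound.
rewrite !big_mkord; under eq_bigr do rewrite fE; under [RHS]eq_bigr do rewrite fE.
by symmetry.
Qed.

(** The map th is an isomorphism of the affine space of dimension r onto X, with
    inverse pr: irreducibility and the transcendence degree are those of a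
    polynomial ring. *)
Lemma parametrized_variety N r (X : set ('I_N -> F)) (th : 'I_N -> {mpoly F[r]})
    (pr : r.-tuple {mpoly F[N]}) :
  zariski_closed X ->
  (forall x, X x <-> exists y, x = fun j => (th j).@[y]) ->
  (forall i y, (tnth pr i).@[fun j => (th j).@[y]] = y i) ->
  affine_variety r X.
Proof.
move=> Xcl Xth prth; pose lq := [tuple th j | j < N].
have evc (p : {mpoly F[N]}) y : (p \mPo lq).@[y] = p.@[fun j => (th j).@[y]].
  by rewrite comp_mpoly_meval; apply: meval_eq => j; rewrite tnth_mktuple.
have Xy y : X (fun j => (th j).@[y]) by apply/Xth; exists y.
split=> //.
  split; first by exists (fun j => (th j).@[fun=> 0]).
  move=> _ _ [S1 ->] [S2 ->] sub; apply: contrapT => /not_orP[n1 n2].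
  have ex (S : set {mpoly F[N]}) : ~ (X `<=` [set x | forall p, S p -> p.@[x] = 0]) ->
      exists2 p, S p & p \mPo lq != 0.
    move=> h; apply: contrapT => /forall2NP h'; apply: h => x /Xth[y ->] p Sp.
    by have [//|/negP/negPn/eqP e] := h' p; rewrite -evc e meval0.
  have [p Sp p0] := ex _ n1; have [q Sq q0] := ex _ n2.
  have /eqP : (p \mPo lq) * (q \mPo lq) = 0.
    apply: meval_eq0 => y; rewrite mevalM !evc.
    by case: (sub _ (Xy y)) => h; [rewrite (h _ Sp) mul0r | rewrite (h _ Sq) mulr0].
  by rewrite mulf_eq0 (negbTE p0) (negbTE q0).
exists pr.
  move=> q h; apply: meval_eq0 => y; rewrite -[RHS](h _ (Xy y)).
  by apply: meval_eq => i; rewrite prth.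
move=> p h; pose P := p \mPo lq.
pose wq := [tuple ('X_(widen_ord (leqnSn r) i) : {mpoly F[r.+1]}) | i < r].
pose Q : {mpoly F[r.+1]} := 'X_ord_max - (P \mPo wq).
have Qev v : Q.@[v] = v ord_max - P.@[fun i => v (widen_ord (leqnSn r) i)].
  rewrite /Q mevalB mevalXU comp_mpoly_meval; congr (_ - _).
  by apply: meval_eq => i; rewrite tnth_mktuple mevalXU.
have Q0 : Q = 0.
  apply: h => x /Xth[y ->]; rewrite Qev /P evc.
  have -> : tnth [tuple of rcons pr p] ord_max = p.
    by rewrite (tnth_nth 0) /= nth_rcons size_tuple ltnn eqxx.
  apply/eqP; rewrite subr_eq0; apply/eqP; apply: meval_eq => j; apply: meval_eq => i.
  rewrite (tnth_nth 0) /= nth_rcons size_tuple ltn_ord -(prth i y).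
  by rewrite (tnth_nth 0).
have := Qev (fun i => if (i < r)%N then 0 else P.@[fun=> 0] + 1).
rewrite Q0 meval0 ltnn (@meval_eq _ _ _ (fun=> 0)); last by move=> i; rewrite /= ltn_ord.
by move/esym/eqP; rewrite addrAC subrr add0r oner_eq0.
Qed.

End InfiniteField.

(** * The level sets of P_mk *)
Section Hypersurface.
Variables (F : fieldType) (char0 : [pchar F] =i pred0) (m k : nat) (k0 : (0 < k)%N).

(** As P_mk is affine in its last variable, with a slope that is a power of x_0
    up to a factor 2, the equation P_mk = e can be solved for this variable. *)
Lemma Pmk_solve (x : nat -> F) (e : F) : x 0%N != 0 ->
  (Pmk F m k).@[fun j => x j] = e <->
  x (m + k)%N = 2%:R * x 0%N ^+ m.+1 / x 0%N ^+ (m + k) *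
    (e - (Pmk F m k).@[fun j => if (j < m + k)%N then x j else 0]).
Proof.
move=> x0; set P' := _.@[fun j => if _ then _ else _].
have := @Pmk_linear F char0 m k (fun j => x j) (fun j => if (j < m + k)%N then x j else 0) k0.
rewrite inordK // -/P' ltnn subr0 => /(_ x0) E.
have {}E : 2%:R * x 0%N ^+ m.+1 * ((Pmk F m k).@[fun j => x j] - P') = x 0%N ^+ (m + k) * x (m + k)%N.
  apply: E => j; rewrite -val_eqE /= => ne.
  by have := ltn_ord j; rewrite ltnS leq_eqVlt (negbTE ne) => /= ->.
have n2 : 2%:R * x 0%N ^+ m.+1 != 0 by rewrite mulf_neq0 ?expf_neq0 // (natr_neq0 char0 1).
have np : x 0%N ^+ (m + k) != 0 by rewrite expf_neq0.
split=> [Pe|xE].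
  by apply: (mulfI np); rewrite -E Pe [RHS]mulrA [_ ^+ (m + k) * _]mulrC divfK.
apply: (addIr (- P')); apply: (mulfI n2); rewrite E xE.
by rewrite mulrA [_ ^+ (m + k) * _]mulrC divfK.
Qed.

Variables (N : nat) (ltp : (m + k < N)%N) (rv : nat -> 'I_N).
(** The coordinates are numbered from the top one down, as in [qform]. *)
Hypothesis rvE : forall i, (i < N)%N -> rv i = (N - i.+1)%N :> nat.
Variables (c : nat -> F) (c0 : c 0%N != 0) (e : F).

Notation r := (N - m - 2)%N.

(** The indices from m + 1 to N - 1, with m + k left out. *)
Let free_index l := (m.+1 + bump k.-1 l)%N.

Let base i : {mpoly F[r]} :=
  if (i <= m)%N then (c i)%:MP
  else if insub (unbump k.-1 (i - m.+1)) is Some l then 'X_l else 0.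

(** The coordinate of index m + k is computed from [base], which gives those below
    it, by solving the equation on P_mk. *)
Let th i : {mpoly F[r]} :=
  if i == (m + k)%N then
    (2%:R * c 0%N ^+ m.+1 / c 0%N ^+ (m + k)) *:
      (e%:MP - (Pmk F m k \mPo [tuple (if (j < m + k)%N then base j else 0) | j < (m + k).+1]))
  else base i.

Let th_const y i : (i <= m)%N -> (th i).@[y] = c i.
Proof. by move=> le; rewrite /th ltn_eqF ?/base ?le ?mevalC //; lia. Qed.

Let th_free y (l : 'I_r) : (th (free_index l)).@[y] = y l.
Proof.
rewrite /th /free_index ifF; last by rewrite /bump; case: leqP; lia.
rewrite /base ifF; last by lia.
by rewrite addKn bumpK valK mevalXU.
Qed.

Let th_top y : (th (m + k)).@[y] = 2%:R * c 0%N ^+ m.+1 / c 0%N ^+ (m + k) *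
  (e - (Pmk F m k).@[fun j => if (j < m + k)%N then (th j).@[y] else 0]).
Proof.
rewrite {1}/th eqxx mevalZ mevalB mevalC comp_mpoly_meval; congr (_ * (_ - _)).
apply: meval_eq => j; rewrite tnth_mktuple; case: ltnP => lt; last by rewrite meval0.
by rewrite /th ltn_eqF.
Qed.

Let free_indexP i : (m < i < N)%N -> i != (m + k)%N -> exists l : 'I_r, i = free_index l.
Proof.
move=> /andP[lt1 lt2] ne; have lt : (unbump k.-1 (i - m.+1) < r)%N.
  by rewrite /unbump; case: ltnP; lia.
exists (Ordinal lt); rewrite /free_index /= unbumpK ?subnKC //.
by rewrite inE; apply: contraNneq ne; lia.
Qed.

(** The set is the graph over the free coordinates of a polynomial function,
    which gives the coordinate of index m + k. *)
Lemma Pmk_hypersurface_variety :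
  affine_variety r [set x : 'I_N -> F |
    (forall i, (i <= m)%N -> x (rv i) = c i) /\ (Pmk F m k).@[fun j => x (rv j)] = e].
Proof.
have rvK (j : 'I_N) : rv (N - j.+1) = j.
  by apply: val_inj; have := ltn_ord j; rewrite /= rvE; lia.
have rvD i : (i < N)%N -> (N - (rv i).+1 = i)%N by move=> lt; rewrite rvE //; lia.
have lt_free (l : 'I_r) : (free_index l < N)%N.
  by have := ltn_ord l; rewrite /free_index /bump; case: leqP; lia.
refine (@parametrized_variety F char0 N r _ (fun j : 'I_N => th (N - j.+1)%N)
         [tuple 'X_(rv (free_index l)) | l < r] _ _ _).
- exists [set q | (exists2 i, (i <= m)%N & q = 'X_(rv i) - (c i)%:MP) \/
      q = (Pmk F m k \mPo [tuple 'X_(rv j) | j < (m + k).+1]) - e%:MP].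
  have PX (x : 'I_N -> F) : ((Pmk F m k \mPo [tuple 'X_(rv j) | j < (m + k).+1]) - e%:MP).@[x] =
      (Pmk F m k).@[fun j => x (rv j)] - e.
    rewrite mevalB mevalC comp_mpoly_meval; congr (_ - _).
    by apply: meval_eq => j; rewrite tnth_mktuple mevalXU.
  apply/seteqP; split=> x /=.
    move=> [h1 h2] q [[i le ->]|->]; first by rewrite mevalB mevalXU mevalC h1 ?subrr.
    by rewrite PX h2 subrr.
  move=> h; split.
    move=> i le; have /eqP := h _ (or_introl (ex_intro2 _ _ i le erefl)).
    by rewrite mevalB mevalXU mevalC subr_eq0 => /eqP.
  by have /eqP := h _ (or_intror erefl); rewrite PX subr_eq0 => /eqP.
- move=> x; split=> [[h1 h2]|[y ->]].
    pose y (l : 'I_r) := x (rv (free_index l)); exists y.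
    have E i : (i < N)%N -> i != (m + k)%N -> (th i).@[y] = x (rv i).
      move=> lt ne; have [le|gt] := leqP i m; first by rewrite th_const ?h1.
      by have [|//|l ->] := @free_indexP i; rewrite ?gt ?lt // th_free.
    apply/funext => j; rewrite -{1}[j]rvK; set i := (N - j.+1)%N.
    have lti : (i < N)%N by rewrite /i; have := ltn_ord j; lia.
    have [->|ne] := eqVneq i (m + k)%N; last by rewrite E.
    have x0 : x (rv 0%N) != 0 by rewrite h1.
    have /(@Pmk_solve (fun i => x (rv i)) _ x0) -> := h2.
    rewrite th_top (h1 0%N isT).
    congr (_ * (_ - _)); apply: meval_eq => l; case: ltnP => // ltl.
    by rewrite E //; lia.
  have E i : (i < N)%N -> (th (N - (rv i).+1)%N).@[y] = (th i).@[y].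
    by move=> lt; rewrite rvD.
  split=> [i le|]; first by rewrite E ?th_const //; lia.
  rewrite (@meval_eq _ _ _ (fun j => (th j).@[y])); last first.
    by move=> j; rewrite E //; have := ltn_ord j; lia.
  apply/(@Pmk_solve (fun i => (th i).@[y])); first by rewrite th_const.
  by rewrite th_top th_const.
- by move=> l y; rewrite tnth_mktuple mevalXU rvD // th_free.
Qed.

End Hypersurface.

(** * Inclusions between the dual spaces *)
Section Inclusions.
Variables (F : fieldType) (char0 : [pchar F] =i pred0).
Implicit Types (a : ser F) (M N n : nat).

Lemma Lincl_proj M N N' (v : Ldual F M N) a :
  Lincl N' v (Lproj M N' a) = v (Lproj M N (Lsect (Lproj M N' a))).
Proof.
rewrite /Lincl linfunE // => c x y.
by rewrite Lsect_lin Lproj_lin linearP.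
Qed.

Lemma Lincl_projE M N N' (v : Ldual F M N) a : (N <= N')%N ->
  Lincl N' v (Lproj M N' a) = v (Lproj M N a).
Proof.
move=> le; rewrite Lincl_proj; congr (v _); apply: eq_Lproj.
by apply: congW (LsectK _); apply: leq_sub2r.
Qed.

Lemma coadq_Lincl M N N' g (v : Ldual F M N) : (0 < M)%N -> (N <= N')%N -> G M g ->
  coadq g (Lincl N' v) = Lincl N' (coadq g v).
Proof.
by move=> M0 le Gg; apply: Ldual_eq => a; rewrite coadq_proj // !Lincl_projE // coadq_proj.
Qed.

Lemma Lincl_orbq M N N' (v : Ldual F M N) : (0 < M)%N -> (N <= N')%N ->
  @Lincl F M N N' @` orbq v = orbq (Lincl N' v).
Proof.
move=> M0 le; apply/seteqP; split=> [_ [_ [g Gg ->] <-]|_ [g Gg ->]].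
  by exists g => //; rewrite coadq_Lincl.
by exists (coadq g v); [exists g|rewrite coadq_Lincl].
Qed.

Definition orb M (lam : ser F -> F) : set (ser F -> F) :=
  [set mu | exists2 g, G M g & mu = coad M g lam].

Lemma coad_Lincl_inf M N g (v : Ldual F M N) : (0 < M)%N -> G M g ->
  coad M g (Lincl_inf v) = Lincl_inf (coadq g v).
Proof. by move=> M0 Gg; apply/funext => a; rewrite /Lincl_inf coadq_proj. Qed.

Lemma Lincl_inf_orbq M N (v : Ldual F M N) : (0 < M)%N ->
  @Lincl_inf F M N @` orbq v = orb M (Lincl_inf v).
Proof.
move=> M0; apply/seteqP; split=> [_ [_ [g Gg ->] <-]|_ [g Gg ->]].
  by exists g => //; rewrite coad_Lincl_inf.
by exists (coadq g v); [exists g|rewrite coad_Lincl_inf].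
Qed.

Lemma Lincl_inf_Lincl M N N' (v : Ldual F M N) : (N <= N')%N ->
  Lincl_inf (Lincl N' v) = Lincl_inf v.
Proof. by move=> le; apply/funext => a; rewrite /Lincl_inf Lincl_projE. Qed.

Lemma Ldual_inf_Lincl_inf M N (v : Ldual F M N) : Ldual_inf M (Lincl_inf v).
Proof.
exists N, (Lincl (M + N) v); rewrite Lincl_inf_Lincl //; exact: leq_addl.
Qed.

Lemma ell_Lincl M N N' (v : Ldual F M N) j : (M <= j < N')%N -> (N' <= N)%N ->
  ell j (Lincl N' v) = ell j v.
Proof.
move=> /andP[lej ltj] le; rewrite /ell -[X in Lincl _ _ X]LprojK Lincl_proj LprojK.
congr (v _); apply/rowP => i; rewrite !mxE /=; case: insubP => [k _ kE|].
  by rewrite mxE -kE.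
by rewrite -leqNgt => lei; case: eqP => // e; have := ltn_ord i; lia.
Qed.

Lemma general_position_orbq m n (lt_mn : (m < n)%N) (v : Ldual F m.+1 n.+1) :
  (2 * m + 2 < n)%N ->
  general_position (orbq v) <-> qform v 0%N != 0.
Proof.
move=> lt; have E (w : Ldual F m.+1 n.+1) : ell n w = qform w 0%N.
  by rewrite qformE ?subn0 // subn_gt0.
split=> [[|[_ h]]|v0]; first by rewrite leqNgt lt.
  by rewrite -E; apply: h; apply: orbq_refl.
by right; split=> // w O; rewrite E -(orbq_qform0 char0 lt_mn O).
Qed.

(** The largest index at which v does not vanish can serve as n'; if it is less
    than min(2m+2, i), then min(2m+2, i) can, by the other clause of general
    position. *)
Lemma minimal_level m i (v : Ldual F m.+1 i.+1) : (m < i)%N ->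
  exists n', (minn (2 * m + 2) i <= n' <= i)%N /\ exists v' : Ldual F m.+1 n'.+1,
    v = Lincl i.+1 v' /\ general_position (orbq v').
Proof.
move=> lt_mi; set a := minn _ _.
pose P n' := [&& (a <= n')%N, (n' <= i)%N & (n' == a) || (ell n' v != 0)].
have exP : exists n', P n' by exists a; rewrite /P leqnn eqxx geq_minr.
have bP n' : P n' -> (n' <= i)%N by case/and3P.
case: (ex_maxnP exP bP) => n' /and3P[len lei Pn'] max.
exists n'; rewrite len lei; split=> //; exists (Lincl n'.+1 v); split.
  apply: Ldual_eq => b; rewrite Lincl_projE ?Lincl_proj // !pairE //.
  set b' := Lsect _; have hb : cong (n' - m) b' b by apply: LsectK.
  rewrite !coefsM; apply: eq_bigr => j _.
  have [lt|ge] := ltnP j (i - n').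
    rewrite qformE; last by have := ltn_ord j; lia.
    have [->|ne] := eqVneq (ell (i - j) v) 0; first by rewrite !mul0r.
    have := max (i - j)%N; rewrite /P ne orbT leq_subr !andbT; lia.
  by rewrite hb //; have := ltn_ord j; lia.
have [|gt] := leqP n' (2 * m + 2); first by left.
apply/general_position_orbq; rewrite ?qformE ?subn0 //; try lia.
rewrite ell_Lincl //; last by lia.
by case/orP: Pn' => // /eqP e; have := geq_minl (2 * m + 2) i; rewrite -/a -e leqNgt gt.
Qed.

End Inclusions.

(** * Orbits in general position *)
Section GeneralPosition.
Variables (F : fieldType) (char0 : [pchar F] =i pred0) (m n : nat) (lt_mn : (m < n)%N).
Notation V := (Ldual F m.+1 n.+1).
Implicit Types (v w : V).

Lemma orbq_point_set v : (n <= 2 * m + 2)%N -> orbq v = [set v].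
Proof.
move=> le; apply/seteqP; split=> [w O|w ->]; last exact: orbq_refl.
exact: orbq_point O.
Qed.

Lemma orbq_odd v w : (2 * m + 2 < n)%N -> odd n -> qform v 0%N != 0 ->
  orbq v w <-> cong m.+1 (qform v) (qform w).
Proof.
move=> lt oddn v0; split=> [/(orbq_low char0 lt_mn)|h].
  by have /minn_idPl -> : (m.+1 <= n - m)%N by lia.
apply: orbq_transitive => // p nE; by exfalso; move: oddn; rewrite nE mul2n odd_double.
Qed.

Lemma ell_qform v (j : 'I_m.+1) : (2 * m + 2 < n)%N -> ell (n - j) v = qform v j.
Proof. by move=> lt; rewrite qformE //; have := ltn_ord j; lia. Qed.

Lemma top_coords_surj (c : 'I_m.+1 -> F) : (2 * m + 2 < n)%N ->
  exists v : V, forall j : 'I_m.+1, ell (n - j) v = c j.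
Proof.
move=> lt; have [v vE] := qform_surj lt_mn (Ser (fun i => c (inord i))); exists v => j.
by rewrite ell_qform // vE /= ?inord_val //; have := ltn_ord j; lia.
Qed.

Lemma top_plane_orbq (c : 'I_m.+1 -> F) v : (2 * m + 2 < n)%N -> odd n -> c ord0 != 0 ->
  (forall j : 'I_m.+1, ell (n - j) v = c j) ->
  [set w : V | forall j : 'I_m.+1, ell (n - j) w = c j] = orbq v.
Proof.
move=> lt oddn c0 vE; have v0 : qform v 0%N != 0 by rewrite -(ell_qform v ord0) // vE.
apply/seteqP; split=> w /=.
  move=> wE; apply/orbq_odd => // i lti.
  by rewrite -(ell_qform v (Ordinal lti)) // -(ell_qform w (Ordinal lti)) // vE wE.
by move=> /orbq_odd-/(_ lt oddn v0) h j; rewrite -vE !ell_qform // h.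
Qed.

(** The direction of the plane is the kernel of the m + 1 top coordinates, which
    are independent. *)
Lemma affine_plane_top (c : {ffun 'I_m.+1 -> F}) : (2 * m + 2 < n)%N ->
  affine_plane (n - 2 * m - 1) [set v : V | forall j : 'I_m.+1, ell (n - j) v = c j].
Proof.
move=> lt.
pose f (v : V) : 'rV[F]_m.+1 := \row_j ell (n - j) v.
have fL : linear f.
  by move=> a x y; apply/rowP => j; rewrite !mxE /ell add_lfunE scale_lfunE.
have fS (r : 'rV[F]_m.+1) : exists v, f v = r.
  have [v vE] := top_coords_surj (fun j => r 0 j) lt; exists v.
  by apply/rowP => j; rewrite mxE vE.
have [v0 v0E] := fS (\row_j c j).
exists v0, (lker (linfun f)).
  have := limg_ker_dim (linfun f) fullv; rewrite capfv.
  have -> : (linfun f @: fullv)%VS = fullv.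
    apply/vspaceP => r; rewrite memvf; apply/memv_imgP.
    by have [v vE] := fS r; exists v; rewrite ?memvf // linfunE.
  rewrite !dimvf /dim /= muln1 !mul1n [dim _]dim_matrix; lia.
apply/seteqP; split=> v /=.
  move=> vE; rewrite memv_ker linfunE // -[v - v0]addrC -scaleN1r fL v0E.
  by apply/eqP/rowP => j; rewrite !mxE vE mulN1r addNr.
rewrite memv_ker linfunE // -[v - v0]addrC -scaleN1r fL v0E => /eqP/rowP h j.
by have /eqP := h j; rewrite !mxE mulN1r addrC subr_eq0 => /eqP.
Qed.

Section Even.
Variables (k : nat) (k0 : (1 < k)%N) (nE : n = (2 * (m + k))%N).

Let lt_pd : (m + k < n - m)%N. Proof. lia. Qed.

(** Up to powers of x_0, P_mk is the difference of two coefficients of square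
    roots, and the second one depends only on the m + 1 top coordinates, hence is
    the same for v and w. *)
Lemma Pmk_normal_sqrt v w : qform v 0%N != 0 -> cong m.+1 (qform v) (qform w) ->
  (Pmk F m k).@[fun j => qform v j] = (Pmk F m k).@[fun j => qform w j] <->
  normal_sqrt (qform v) (m + k)%N = normal_sqrt (qform w) (m + k)%N.
Proof.
move=> v0 low; have e0 : qform v 0%N = qform w 0%N by apply: low.
have w0 : qform w 0%N != 0 by rewrite -e0.
have [a0 a1] := normal_sqrtP char0 v0; have [b0 b1] := normal_sqrtP char0 w0.
have [c0 c1] := normal_sqrtP char0
  (phi := Ser (fun i => if (i <= m)%N then qform v i else 0)) v0.
set psim := normal_sqrt _ in c0 c1.
have SerE (h : nat -> F) i : Ser h i = h i by [].
have top (u : V) : cong (m + k).+1 (qform u)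
    (Ser (fun i => if (i <= m + k)%N then qform u (@inord (m + k) i) else 0)).
  by move=> i; rewrite ltnS [RHS]SerE => le; rewrite le inordK.
have mid (u : V) : cong m.+1 (qform v) (qform u) -> cong (m + k).+1
    (Ser (fun i => if (i <= m)%N then qform v i else 0))
    (Ser (fun i => if (i <= m)%N then qform u (@inord (m + k) i) else 0)).
  by move=> h i lt; rewrite [LHS]SerE [RHS]SerE; case: leqP => // le; rewrite inordK // -h.
have Ev := @Pmk_eval F char0 m k (fun j => qform v j) (normal_sqrt (qform v)) psim.
have Ew := @Pmk_eval F char0 m k (fun j => qform w j) (normal_sqrt (qform w)) psim.
rewrite !inordK // in Ev Ew.
have {}Ev := Ev v0 a0 c0; have {}Ew := Ew w0 b0 c0.
have {}Ev : qform v 0%N ^+ m * (Pmk F m k).@[fun j => qform v j] =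
    qform v 0%N ^+ (m + k) * (normal_sqrt (qform v) (m + k)%N - psim (m + k)%N).
  by apply: Ev; [rewrite a1; apply: top | rewrite [serC _ * _]c1; apply: mid].
have {}Ew : qform v 0%N ^+ m * (Pmk F m k).@[fun j => qform w j] =
    qform v 0%N ^+ (m + k) * (normal_sqrt (qform w) (m + k)%N - psim (m + k)%N).
  by rewrite e0; apply: Ew; [rewrite b1; apply: top | rewrite -e0 [serC _ * _]c1; apply: mid].
have nz i : qform v 0%N ^+ i != 0 by rewrite expf_neq0.
split=> h.
  by apply: (addIr (- psim (m + k)%N)); apply: (mulfI (nz (m + k)%N)); rewrite -Ev -Ew h.
by apply: (mulfI (nz m)); rewrite Ev Ew h.
Qed.

Lemma orbq_even v w : qform v 0%N != 0 ->
  orbq v w <-> cong m.+1 (qform v) (qform w) /\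
   (Pmk F m k).@[fun j => qform v j] = (Pmk F m k).@[fun j => qform w j].
Proof.
move=> v0; split=> [O|[h P]].
  have h : cong m.+1 (qform v) (qform w).
    have := orbq_low char0 lt_mn O.
    by have /minn_idPl -> : (m.+1 <= n - m)%N by lia.
  split=> //; apply/Pmk_normal_sqrt => //; apply: orbq_normal_sqrt O => //; lia.
apply: orbq_transitive => //; first by lia.
move=> p np; have -> : p = (m + k)%N by lia.
by apply/Pmk_normal_sqrt.
Qed.

Definition level (c : nat -> F) (e : F) : set V :=
  [set v | (forall i, (i <= m)%N -> qform v i = c i) /\ (Pmk F m k).@[fun j => qform v j] = e].

Lemma level_nonempty c e : c 0%N != 0 -> exists v, level c e v.
Proof.
move=> c0; pose y i := if (i <= m)%N then c i else 0.
pose x i := if i == (m + k)%N then 2%:R * y 0%N ^+ m.+1 / y 0%N ^+ (m + k) *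
    (e - (Pmk F m k).@[fun j => if (j < m + k)%N then y j else 0]) else y i.
have [v vE] := qform_surj lt_mn (Ser x); exists v.
have xE i : (i < m + k)%N -> x i = y i by rewrite /x => lt; rewrite ltn_eqF.
split=> [i le|].
  by rewrite vE /= ?xE /y ?le //; lia.
rewrite (@meval_eq _ _ _ (fun j => x j)); last first.
  by move=> j; rewrite vE //; have := ltn_ord j; lia.
have pos : (0 < m + k)%N by lia.
have x0 : x 0%N != 0 by rewrite xE.
apply/(@Pmk_solve F char0 _ _ (ltnW k0) x e x0).
rewrite (xE _ pos) {1}/x eqxx; congr (_ * (_ - _)); apply: meval_eq => j.
by case: ltnP => // lt; rewrite xE.
Qed.

Lemma level_orbq c e v : c 0%N != 0 -> level c e v -> level c e = orbq v.
Proof.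
move=> c0 [v1 v2]; have v0 : qform v 0%N != 0 by rewrite v1.
apply/seteqP; split=> w.
  move=> [w1 w2]; apply/orbq_even => //; split; last by rewrite v2 w2.
  by move=> i; rewrite ltnS => le; rewrite v1 ?w1.
move=> /orbq_even[] // h P; split; last by rewrite -P.
by move=> i le; rewrite -h ?v1.
Qed.

Lemma level_variety c e : c 0%N != 0 -> affine_variety (n - 2 * m - 2) (in_coords (level c e)).
Proof.
move=> c0; have d0 : (0 < n - m)%N by lia.
pose rv i : 'I_(n - m) := insubd (Ordinal d0) (n - m - i.+1)%N.
have rvE i : (i < n - m)%N -> rv i = (n - m - i.+1)%N :> nat.
  by move=> lt; rewrite /rv val_insubd ifT //; lia.
have k1 : (0 < k)%N by lia.
have := Pmk_hypersurface_variety char0 k1 lt_pd rvE c0 e.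
have -> : (n - m - m - 2 = n - 2 * m - 2)%N by lia.
congr affine_variety; apply/seteqP; split=> x /=.
  move=> [h1 h2]; have [v vE] := qform_surj lt_mn (Ser (fun i => x (rv i))).
  have {}vE i : (i < n - m)%N -> qform v i = x (rv i) by move=> lt; rewrite vE.
  exists v; last first.
    apply/funext => -[j ltj]; have lt : (j < n - m)%N := ltj.
    have -> : (m.+1 + Ordinal ltj = n - (n - m - j.+1))%N by rewrite /=; lia.
    rewrite -qformE ?vE; try lia.
    by congr x; apply: val_inj; rewrite /= rvE; lia.
  split=> [i le|]; first by rewrite vE ?h1 //; lia.
  rewrite -h2; apply: meval_eq => j; rewrite vE //; have := ltn_ord j; lia.
move=> [v [h1 h2] ->].
have E i : (i < n - m)%N -> ell (m.+1 + rv i) v = qform v i.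
  by move=> lt; rewrite qformE // rvE //; congr (ell _ v); lia.
split=> [i le|]; first by rewrite E ?h1 //; lia.
rewrite -h2; apply: meval_eq => j; rewrite E //; have := ltn_ord j; lia.
Qed.

End Even.

End GeneralPosition.

Theorem theorem2 (F : fieldType) (char0 : [pchar F] =i pred0)
    (m n : nat) (lt_mn : (m < n)%N) :
  (* (1) *)
  ((n <= 2 * m + 2)%N ->
    forall O : set (Ldual F m.+1 n.+1),
      (is_orbitq O <-> exists v, O = [set v]) /\
      (is_orbitq O -> general_position O)) /\
  (* (2) *)
  ((2 * m + 2 < n)%N -> odd n ->
    let V := fun c : {ffun 'I_m.+1 -> F} =>
      [set v : Ldual F m.+1 n.+1 | forall j : 'I_m.+1, ell (n - j) v = c j] in
    set_bij [set c : {ffun 'I_m.+1 -> F} | c ord0 != 0]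
            [set O | is_orbitq O /\ general_position O] V /\
    forall c : {ffun 'I_m.+1 -> F}, c ord0 != 0 -> affine_plane (n - 2 * m - 1) (V c)) /\
  (* (3) *)
  ((2 * m + 2 < n)%N -> ~~ odd n ->
    let k := (n./2 - m)%N in
    let V := fun c : {ffun 'I_m.+2 -> F} =>
      [set v : Ldual F m.+1 n.+1 |
        (forall j : 'I_m.+2, (j <= m)%N -> ell (n - j) v = c j) /\
        (Pmk F m k).@[fun j => ell (n - j) v] = c ord_max] in
    set_bij [set c : {ffun 'I_m.+2 -> F} | c ord0 != 0]
            [set O | is_orbitq O /\ general_position O] V /\
    forall c : {ffun 'I_m.+2 -> F}, c ord0 != 0 -> affine_variety (n - 2 * m - 2) (in_coords (V c))) /\
  (* (4) *)
  (forall O : set (Ldual F m.+1 n.+1),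
    is_orbitq O -> general_position O ->
    (forall i, (n <= i)%N -> is_orbitq (@Lincl F m.+1 n.+1 i.+1 @` O)) /\
    is_orbit m.+1 (@Lincl_inf F m.+1 n.+1 @` O)) /\
  (* (5) *)
  (forall i, (m < i)%N ->
    forall O : set (Ldual F m.+1 i.+1), is_orbitq O ->
    exists n', (minn (2 * m + 2) i <= n' <= i)%N /\
    exists O' : set (Ldual F m.+1 n'.+1),
      [/\ is_orbitq O', general_position O' &
          O = @Lincl F m.+1 n'.+1 i.+1 @` O']) /\
  (* (6) *)
  (forall O : set (ser F -> F), is_orbit m.+1 O ->
    exists n', (2 * m + 2 <= n')%N /\
    exists O' : set (Ldual F m.+1 n'.+1),
      [/\ is_orbitq O', general_position O' &
          O = @Lincl_inf F m.+1 n'.+1 @` O']).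
Proof.
have M0 : (0 < m.+1)%N by [].
have orbP i (lt : (m < i)%N) (O : set (Ldual F m.+1 i.+1)) :
    is_orbitq O <-> exists v, O = orbq v.
  by apply: is_orbitqE; rewrite // ltnS ltnW.
split; [|split; [|split; [|split; [|split]]]].
- move=> le O; split; last by move=> _; left.
  have E (v : Ldual F m.+1 n.+1) : orbq v = [set v] by apply: orbq_point_set.
  by split=> [/orbP-/(_ lt_mn)|] [v ->]; [|apply/orbP => //]; exists v; rewrite E.
- move=> lt oddn V.
  have VP (c : {ffun 'I_m.+1 -> F}) : c ord0 != 0 -> exists2 v, V c = orbq v & qform v 0%N != 0.
    move=> c0; have [v vE] := top_coords_surj lt_mn c lt.
    exists v; first exact: top_plane_orbq.
    by rewrite -(ell_qform lt_mn v ord0) // vE.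
  split; last by move=> c _; apply: affine_plane_top.
  split.
  + move=> c /= /VP[v -> v0]; split; first by apply/orbP => //; exists v.
    exact/general_position_orbq.
  + move=> c c'; rewrite !inE => c0 c'0 e; have [v vE _] := VP c c0.
    have v1 : V c v by rewrite vE; apply: orbq_refl.
    have v2 : V c' v by rewrite -e.
    by apply/ffunP => j; rewrite -v1 -v2.
  + move=> O [/orbP-/(_ lt_mn)[v ->] /general_position_orbq-/(_ char0 lt_mn lt) v0].
    exists [ffun j : 'I_m.+1 => ell (n - j) v].
      by rewrite /= ffunE ell_qform.
    apply: top_plane_orbq => //; first by rewrite ffunE ell_qform.
    by move=> j; rewrite ffunE.
- move=> lt evenn k V.
  have nE : n = (2 * (m + k))%N.
    by have := even_halfK evenn; rewrite /k -mul2n; lia.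
  have k1 : (1 < k)%N by lia.
  pose cf (c : {ffun 'I_m.+2 -> F}) i : F := c (inord i).
  have cf0 c : cf c 0%N = c ord0 by congr (c _); apply: val_inj; rewrite /= inordK.
  have VE c : V c = level k (cf c) (c ord_max).
    apply/seteqP; split=> v [h1 h2]; split.
    + move=> i le; rewrite qformE; last by lia.
      have e : nat_of_ord (inord i : 'I_m.+2) = i by rewrite inordK //; lia.
      by rewrite -[in LHS]e h1 // e.
    + rewrite -h2; apply: meval_eq => j; rewrite qformE //; have := ltn_ord j; lia.
    + move=> j le; rewrite -qformE; last by lia.
      by rewrite h1 // /cf inord_val.
    + rewrite -h2; apply: meval_eq => j; rewrite qformE //; have := ltn_ord j; lia.
  have VP (c : {ffun 'I_m.+2 -> F}) : c ord0 != 0 -> exists2 v, V c = orbq v & qform v 0%N != 0.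
    rewrite -cf0 => c0; have [v vE] := level_nonempty char0 lt_mn k1 nE (c ord_max) c0.
    exists v; first by rewrite VE; apply: level_orbq.
    by rewrite (vE.1 0%N).
  split; last by move=> c c0; rewrite VE; apply: level_variety => //; rewrite cf0.
  split.
  + move=> c /= /VP[v -> v0]; split; first by apply/orbP => //; exists v.
    exact/general_position_orbq.
  + move=> c c'; rewrite !inE => c0 c'0 e; have [v vE _] := VP c c0.
    have v1 : V c v by rewrite vE; apply: orbq_refl.
    have v2 : V c' v by rewrite -e.
    apply/ffunP => j; have [le|gt] := leqP j m; first by rewrite -v1.1 // -v2.1.
    have -> : j = ord_max by apply: val_inj; have := ltn_ord j; rewrite /=; lia.
    by rewrite -v1.2 -v2.2.
  + move=> O [/orbP-/(_ lt_mn)[v ->] /general_position_orbq-/(_ char0 lt_mn lt) v0].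
    exists [ffun j : 'I_m.+2 => if (j <= m)%N then qform v j else (Pmk F m k).@[fun j => qform v j]].
      by rewrite /= ffunE.
    rewrite VE; apply: level_orbq => //; first by rewrite cf0 ffunE.
    split; last by rewrite ffunE ltnn.
    move=> i le; rewrite /cf ffunE inordK ?le //; lia.
- move=> O /orbP-/(_ lt_mn)[v ->] gp; split.
    move=> i le; apply/orbP; first exact: leq_trans le.
    by exists (Lincl i.+1 v); rewrite Lincl_orbq.
  exists (Lincl_inf v); first exact: Ldual_inf_Lincl_inf.
  by rewrite Lincl_inf_orbq.
- move=> i lt_mi O /orbP-/(_ lt_mi)[v ->].
  have [n' [/andP[len lei] [v' [vE gp]]]] := minimal_level char0 v lt_mi.
  exists n'; rewrite len lei; split=> //; exists (orbq v'); split=> //.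
    by apply/orbP; [lia | exists v'].
  by rewrite Lincl_orbq // -vE.
- move=> O [lam [k [v0 lamE]] OE]; pose i := (2 * m + 2 + k)%N.
  have lt_mi : (m < i)%N by rewrite /i; lia.
  pose v := Lincl i.+1 v0.
  have {}lamE : lam = Lincl_inf v by rewrite lamE Lincl_inf_Lincl // /i; lia.
  have [n' [/andP[len lei] [v' [vE gp]]]] := minimal_level char0 v lt_mi.
  exists n'; split; first by rewrite /i in len; lia.
  exists (orbq v'); split=> //.
    by apply/orbP; [lia | exists v'].
  rewrite OE lamE vE Lincl_inf_Lincl ?ltnS // Lincl_inf_orbq //.
Qed.
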